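(* Let $\mathcal{H}_1,\ldots,\mathcal{H}_s$ be nice hypergraphs and let $t=\min_j\chi(\operatorname{KG}(\mathcal{H}_j))$. Then any proper coloring of $\operatorname{KG}(\mathcal{H}_1)\times\cdots\times\operatorname{KG}(\mathcal{H}_s)$ with $t$ colors contains a colorful copy of $K^*_{t,t}$ with all $t$ colors appearing on each side.
   Context: A hypergraph $\mathcal{H}$ is a pair $(V(\mathcal{H}),E(\mathcal{H}))$ where $V(\mathcal{H})$ is a nonempty finite set and $E(\mathcal{H})$ is a finite collection of (nonempty) subsets of $V(\mathcal{H})$. It is nonempty if it has at least one edge. A singleton is an edge with a single vertex. The general Kneser graph $\operatorname{KG}(\mathcal{H})$ has the edges of $\mathcal{H}$ as vertices, two of them being adjacent if they are disjoint as sets. $\chi$ is the chromatic number. $[n]=\{1,\ldots,n\}$. For $\boldsymbol{x}=(x_1,\ldots,x_n)\in\{+,-,0\}^n$: $\boldsymbol{x}^+=\{i:x_i=+\}$, $\boldsymbol{x}^-=\{i:x_i=-\}$, $|\boldsymbol{x}|$ is the number of nonzero $x_i$, and $\operatorname{alt}(\boldsymbol{x})$ is the length of a longest alternating subsequence of $\boldsymbol{x}$, i.e., a sequence $x_{i_1},\ldots,x_{i_\ell}$ of nonzero terms with $i_1<\cdots<i_\ell$ in which any two consecutive terms differ (with $\operatorname{alt}(\boldsymbol{0})=0$). For a nonempty hypergraph $\mathcal{H}$ with $n$ vertices and a bijection $\sigma:[n]\to V(\mathcal{H})$, $\operatorname{alt}_\sigma(\mathcal{H})=\max\{\operatorname{alt}(\boldsymbol{x}):\boldsymbol{x}\in\{+,-,0\}^n,\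 \text{none of }\sigma(\boldsymbol{x}^+)\text{ and }\sigma(\boldsymbol{x}^-)\text{ contains an edge of }\mathcal{H}\}$. A hypergraph $\mathcal{H}$ is nice if it is nonempty, has no singletons, and there is a bijection $\sigma:[n]\to V(\mathcal{H})$ for which (i) $\chi(\operatorname{KG}(\mathcal{H}))=n-\operatorname{alt}_\sigma(\mathcal{H})$, and (ii) every $\boldsymbol{x}\in\{+,-,0\}^n$ with $\operatorname{alt}(\boldsymbol{x})\ge\operatorname{alt}_\sigma(\mathcal{H})$ and $|\boldsymbol{x}|>\operatorname{alt}_\sigma(\mathcal{H})$ is such that at least one of $\sigma(\boldsymbol{x}^+)$ and $\sigma(\boldsymbol{x}^-)$ contains some edge of $\mathcal{H}$. The categorical product $G_1\times\cdots\times G_s$ of graphs has vertex set $V(G_1)\times\cdots\times V(G_s)$, with $(u_1,\ldots,u_s)$ and $(v_1,\ldots,v_s)$ adjacent if $u_iv_i\in E(G_i)$ for every $i$. $K_{q,q}^*$ is the bipartite graph obtained from the complete bipartite graph $K_{q,q}$ by removing a perfect matching; its sides have $q$ vertices each. A copy of it in a graph is a (not necessarily induced) subgraph isomorphic to it, so its $2q$ vertices are pairwise distinct. Colorful means that all colors appear in the subgraph. *)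

(* Defs.v *)
From HB Require Import structures.
From mathcomp Require Import all_boot.

Set Implicit Arguments.
Unset Strict Implicit.
Unset Printing Implicit Defensive.

Record graph := Graph {
  vertex :> finType;
  adj : rel vertex;
  adj_sym : symmetric adj;
  adj_irr : irreflexive adj }.

Definition proper_coloring (G : graph) (C : eqType) (c : G -> C) : bool :=
  [forall u, forall v, adj u v ==> (c u != c v)].

Definition colorable (G : graph) (k : nat) : bool :=
  [exists c : {ffun G -> 'I_k}, proper_coloring c].

Lemma colorable_ex (G : graph) : exists k, colorable G k.
Proof.
exists #|G|; apply/existsP; exists [ffun u => enum_rank u].
apply/forallP => u; apply/forallP => v; apply/implyP => uv.
rewrite !ffunE (inj_eq enum_rank_inj).
by apply: contraTneq uv => ->; rewrite adj_irr.
Qed.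

Definition chi (G : graph) : nat := ex_minn (colorable_ex G).

(* The index set is nonempty: the empty product would be a loop. *)
Section CategoricalProduct.
Variables (s : nat) (G : 'I_s.+1 -> graph).

Definition cat_prod_vertex : finType := {dffun forall i : 'I_s.+1, G i}.

Definition cat_prod_adj (u v : cat_prod_vertex) : bool :=
  [forall i, adj (u i) (v i)].

Lemma cat_prod_sym : symmetric cat_prod_adj.
Proof. by move=> u v; apply: eq_forallb => i; rewrite adj_sym. Qed.

Lemma cat_prod_irr : irreflexive cat_prod_adj.
Proof. by move=> u; apply/forallP => /(_ ord0); rewrite adj_irr. Qed.

Definition cat_prod : graph := Graph cat_prod_sym cat_prod_irr.

End CategoricalProduct.

(* The complete bipartite graph with sides inl and inr, minus the perfect
   matching made of the pairs {inl i, inr i}. *)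
Section KStar.
Variable q : nat.

Definition Kstar_adj (u v : 'I_q + 'I_q) : bool :=
  match u, v with
  | inl i, inr j | inr i, inl j => i != j
  | _, _ => false
  end.

Lemma Kstar_sym : symmetric Kstar_adj.
Proof. by case=> i [] j //=; rewrite eq_sym. Qed.

Lemma Kstar_irr : irreflexive Kstar_adj.
Proof. by case. Qed.

Definition Kstar : graph := Graph Kstar_sym Kstar_irr.

End KStar.

Definition is_copy (F G : graph) (f : F -> G) : Prop :=
  injective f /\ forall u v : F, adj u v -> adj (f u) (f v).

Definition all_colors_appear (T : Type) (k : nat) (c : T -> 'I_k) : Prop :=
  forall a : 'I_k, exists x : T, c x = a.

Record hypergraph := Hypergraph {
  hvertex : finType;
  hedges : {set {set hvertex}};
  hvertex_gt0 : 0 < #|hvertex|;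
  hedges_neq0 : set0 \notin hedges }.

Section Kneser.
Variable H : hypergraph.

Definition KG_vertex : finType := {e : {set hvertex H} | e \in hedges H}.

Definition KG_adj (e f : KG_vertex) : bool := [disjoint val e & val f].

Lemma KG_sym : symmetric KG_adj.
Proof. by move=> e f; rewrite /KG_adj disjoint_sym. Qed.

Lemma KG_irr : irreflexive KG_adj.
Proof.
move=> e; rewrite /KG_adj -setI_eq0 setIid; apply/eqP => e0.
by have := hedges_neq0 H; rewrite -e0 (valP e).
Qed.

Definition KG : graph := Graph KG_sym KG_irr.

End Kneser.

(* Some true, Some false and None stand for +, - and 0. *)
Definition signvec (n : nat) : finType := {ffun 'I_n -> option bool}.

Section SignVectors.
Variables (n : nat) (x : signvec n).

Definition pos_part : {set 'I_n} := [set i | x i == Some true].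
Definition neg_part : {set 'I_n} := [set i | x i == Some false].
Definition supp_size : nat := #|[set i | x i != None]|.

Definition alternating (r : seq (option bool)) : bool :=
  all isSome r && sorted (fun a b => a != b) r.

(* enum I lists I in increasing order, so [seq x i | i <- enum I] is the
   subsequence of x supported by I. *)
Definition alt : nat :=
  \max_(I : {set 'I_n} | alternating [seq x i | i <- enum I]) #|I|.

End SignVectors.

Section Nice.
Variable H : hypergraph.
Let n := #|hvertex H|.

Definition contains_edge (A : {set hvertex H}) : bool :=
  [exists e in hedges H, e \subset A].

Definition alt_sigma (sigma : 'I_n -> hvertex H) : nat :=
  \max_(x : signvec n | ~~ contains_edge (sigma @: pos_part x)
                        && ~~ contains_edge (sigma @: neg_part x)) alt x.

(* alt_sigma is at most n, so the subtraction below is not truncated. *)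
Definition nice : Prop :=
  [/\ hedges H != set0,
      forall v : hvertex H, [set v] \notin hedges H
    & exists sigma : 'I_n -> hvertex H,
      [/\ bijective sigma,
          chi (KG H) = n - alt_sigma sigma
        & forall x : signvec n,
            alt_sigma sigma <= alt x -> alt_sigma sigma < supp_size x ->
            contains_edge (sigma @: pos_part x)
            || contains_edge (sigma @: neg_part x)]].

End Nice.

(* Main.v *)
Require Import Defs.
From HB Require Import structures.
From mathcomp Require Import all_boot all_fingroup.
From mathcomp Require Import zify.

(** A Fan-type theorem is applied on the sphere of sign vectors on the disjoint
    union of the vertex sets, ordered by extension; its maximal flags add one
    signed coordinate at a time. For any antipodal choice of signs, the number
    of flags along which the signs alternate is odd; and for a fixed vector z,
    the numbers of flags through z whose signs alternate from z on, starting
    with + or with -, have the same parity.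

    For t >= 3 these signs come with a monotone label in {1, ..., N}, where N is
    the number of coordinates, such that comparable vectors of equal label have
    equal sign; along an alternating flag the k-th vector then has label k. The
    label of x is N - t plus the largest color of a tuple of edges lying, for
    all hypergraphs at once, in the + side or in the - side of x. When there is
    none, it is a sum over the hypergraphs H_j: the alternation number of the
    restriction x_j of x if neither side of x_j contains an edge, alt(H_j) + 1
    if exactly one does, and otherwise alt(H_j) plus the largest color, in an
    optimal coloring of KG(H_j), of an edge inside a side of x_j. This sum is at
    most N - t, and on a flag equality forces one x_j to be free of edges and
    all others to be full; niceness then gives, for each of the t unused
    coordinates u and each sign b, a tuple on side b of z extended by u with
    sign b. Let C_b(u) be the set of colors of these tuples. Then C_+(u) and
    C_-(u') are disjoint when u and u' differ, and two oppositely alternating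
    flags through z force, by induction on i, a coordinate u_i with
    C_+(u_i) = C_-(u_i) = {i}: these tuples form the required copy.

    For t <= 2 two opposite one-sided x_j spoil the bound or its equality case, but
    each nice hypergraph on its own provides enough disjoint edges. *)

Set Implicit Arguments.
Unset Strict Implicit.
Unset Printing Implicit Defensive.

(** * Parity of alternating flags *)

Fixpoint altw (b : bool) (m : nat) : seq bool :=
  if m is m'.+1 then b :: altw (~~ b) m' else [::].

Definition del (i : nat) (w : seq bool) : seq bool := take i w ++ drop i.+1 w.

Lemma size_altw b m : size (altw b m) = m.
Proof. by elim: m b => //= m IH b; rewrite IH. Qed.

Lemma nth_altw d b m i : i < m -> nth d (altw b m) i = b (+) odd i.
Proof.
elim: m b i => // m IH b [|i] /= lt_im; first by rewrite addbF.
by rewrite IH // addNb addbN.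
Qed.

Lemma altwD b m p : altw b (m + p) = altw b m ++ altw (b (+) odd m) p.
Proof.
elim: m b => [|m IH] b /=; first by rewrite addbF.
by rewrite IH addNb addbN.
Qed.

Lemma map_negb_altw b m : map negb (altw b m) = altw (~~ b) m.
Proof. by elim: m b => //= m IH b; rewrite IH. Qed.

(** An alternating word gives the target only when it loses its first or its last letter, whichever
    fits [b]; any other word that gives it has a single pair of equal neighbours, and deleting
    either of them does. *)
Lemma odd_del_altw b m w : size w = m.+1 ->
  odd (\sum_(i < m.+1) (del i w == altw b m)) =
    (w == altw b m.+1) (+) (w == altw (~~ b) m.+1).
Proof.
elim: m b w => [|m IH] b [|x w] //= [].
  by case: w => // _; rewrite big_ord_recl big_ord0 /del /=; case: x; case: b.
case=> sz_w; rewrite big_ord_recl oddD oddb.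
rewrite (eq_bigr (fun i : 'I_m.+1 => (x == b) && (del i w == altw (~~ b) m) : nat));
  last by move=> i _; rewrite /del /= eqseq_cons.
have -> : del (@ord0 m.+1) (x :: w) = w by rewrite /del /= drop0.
have [->|/negbTE x_neq] := eqVneq x b.
  rewrite (eq_bigr (fun i : 'I_m.+1 => del i w == altw (~~ b) m : nat)) //.
  rewrite IH //= -!/(altw _ m.+1) !eqseq_cons eqxx /= negbK.
  have -> : (b == ~~ b) = false by case: b.
  by rewrite addbF addbC -addbA addbb addbF.
rewrite big1 // addbF !eqseq_cons x_neq /= negbK.
by have -> : x == ~~ b by case: x b x_neq => [] [].
Qed.

Lemma even_card_involution (T : finType) (A : {set T}) (f : T -> T) :
    {in A, forall x, f x \in A} -> {in A, involutive f} ->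
    {in A, forall x, f x != x} ->
  ~~ odd #|A|.
Proof.
have [n] := ubnP #|A|; elim: n A => // n IH A le_An fA ff fx.
have [->|[x Ax]] := set_0Vmem A; first by rewrite cards0.
have fxA : f x \in A :\ x by rewrite !inE fx ?fA.
rewrite (cardsD1 x A) Ax (cardsD1 (f x)) fxA /= negbK.
move: le_An; rewrite (cardsD1 x A) Ax (cardsD1 (f x)) fxA /= => le_An.
have sub y : y \in A :\ x :\ f x -> y \in A by rewrite !inE => /and3P[].
apply: IH; [lia | move=> y yB | |]; last 2 first.
- by move=> y /sub /ff.
- by move=> y /sub /fx.
have Ay := sub _ yB; move: yB; rewrite !inE fA // andbT => /and3P[y_fx y_x _].
by rewrite (can_in_eq ff) // y_x -(inj_in_eq (can_in_inj ff)) ?fA // ff //.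
Qed.

Section Flags.
Variable N : nat.

(* A maximal chain of sign vectors: [F.1 i] is the step at which coordinate [i]
   becomes nonzero, and [F.2 i] the sign it then takes. *)
Definition flag : finType := ({perm 'I_N} * {ffun 'I_N -> bool})%type.

Implicit Types (F : flag) (x : signvec N).

Definition fvec (k : nat) F : signvec N :=
  [ffun i => if F.1 i < k then Some (F.2 i) else None].

(** The two local moves on a flag: exchanging consecutive steps changes a single member of the
    chain, flipping the sign taken at step [p] changes only the members with more than [p] nonzero
    coordinates. *)
Definition fswap (p q : 'I_N) F : flag := ((F.1 * tperm p q)%g, F.2).

Definition fflip (p : 'I_N) F : flag :=
  (F.1, [ffun i => F.2 i (+) (F.1 i == p)]).

Lemma fswapK p q : involutive (fswap p q).
Proof. by case=> s e; rewrite /fswap /= -mulgA tperm2 mulg1. Qed.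

Lemma fflipK p : involutive (fflip p).
Proof.
by case=> s e; congr (_, _); apply/ffunP=> i; rewrite !ffunE /= -addbA addbb addbF.
Qed.

Lemma fswap_neq p q F : p != q -> fswap p q F != F.
Proof.
move=> pq; apply/eqP => /(congr1 (fun G : flag => G.1 (F.1^-1 p)%g)).
by rewrite /= permM permKV tpermL => qp; rewrite qp eqxx in pq.
Qed.

Lemma fflip_neq p F : fflip p F != F.
Proof.
apply/eqP => /(congr1 (fun G : flag => G.2 (F.1^-1 p)%g)).
by rewrite ffunE permKV eqxx addbT; case: (F.2 _).
Qed.

Lemma fvec_swap (k : nat) (p q : 'I_N) F : q = p.+1 :> nat -> k != q ->
  fvec k (fswap p q F) = fvec k F.
Proof.
move=> qE k_q; apply/ffunP=> i; rewrite !ffunE permM.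
by case: tpermP => [->|->|//]; congr (if _ then _ else _); lia.
Qed.

Lemma fvec_flip k (p : 'I_N) F : k <= p -> fvec k (fflip p F) = fvec k F.
Proof.
move=> le_kp; apply/ffunP=> i; rewrite !ffunE /=.
by have [->|_] := eqVneq; [rewrite ltnNge le_kp | rewrite addbF].
Qed.

Section Words.
Variable sg : signvec N -> bool.

(** Starting at [a + 1] leaves out the zero vector when [a = 0]: antipodality says nothing about its
    sign. *)
Definition word (a m : nat) F : seq bool :=
  [seq sg (fvec k F) | k <- iota a.+1 m].

Lemma size_word a m F : size (word a m F) = m.
Proof. by rewrite size_map size_iota. Qed.

Lemma word_cat a m p F : word a (m + p) F = word a m F ++ word (a + m) p F.
Proof. by rewrite /word iotaD map_cat addSn. Qed.

Lemma nth_word d a m i F : i < m ->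
  nth d (word a m F) i = sg (fvec (a + i).+1 F).
Proof. by move=> im; rewrite (nth_map 0) ?size_iota // nth_iota // addSn. Qed.

Lemma eq_word a m F F' :
    (forall k, a < k <= a + m -> fvec k F = fvec k F') ->
  word a m F = word a m F'.
Proof.
by move=> E; apply/eq_in_map => k; rewrite mem_iota => ?; rewrite E //; lia.
Qed.

Lemma del_word a m i F : i < m -> del i (word a m F) =
  word a i F ++ word (a + i.+1) (m - i.+1) F.
Proof.
move=> lt_im; have -> : m = i + (1 + (m - i.+1)) by lia.
rewrite word_cat word_cat /del take_size_cat ?size_word //.
rewrite -addn1 addnC -drop_drop drop_size_cat ?size_word //=.
by rewrite drop0 addn1 addnS; congr (_ ++ word _ _ _); lia.
Qed.

(* Deleting one letter of the word of a flag is insensitive to changing the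
   corresponding member of the chain, which for all but the last letter can be
   done in exactly one way, within S. *)
Lemma odd_alt_words a m (S : {set flag}) :
    a + m < N ->
    (forall p q : 'I_N, a <= p -> q = p.+1 :> nat -> q <= a + m ->
       {in S, forall F, fswap p q F \in S}) ->
  odd #|[set F in S | word a m.+1 F == altw true m.+1]|
    (+) odd #|[set F in S | word a m.+1 F == altw false m.+1]|
  = odd #|[set F in S | word a m F == altw true m]|.
Proof.
move=> lt_N S_swap.
(* Pairs of a flag and a deleted letter are counted in two ways: by letter, only the last one
   survives modulo 2; by flag, [odd_del_altw] applies. *)
pose A (i : nat) := [set F in S | del i (word a m.+1 F) == altw true m].
have cA i : #|A i| = \sum_(F in S) (del i (word a m.+1 F) == altw true m).
  by rewrite -sum1dep_card big_mkcondr; apply: eq_bigr => F _; case: eqP.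
have odd_addb (P : pred flag) :
    odd #|[set F in S | P F]| = \big[addb/false]_(F in S) P F.
  rewrite -sum1dep_card (big_morph odd oddD (erefl : odd 0 = false)) big_mkcondr.
  by apply: eq_bigr => F _; case: (P F).
have -> : #|[set F in S | word a m F == altw true m]| = #|A m|.
  apply: eq_card => F; rewrite !inE del_word // subnn cats0.
  by [].
have E : odd (\sum_(i < m.+1) #|A i|) = odd #|A m|.
  rewrite big_ord_recr /= oddD -[RHS]addFb; congr (_ (+) _).
  rewrite (big_morph odd oddD (erefl : odd 0 = false)) big1 // => -[i lt_im] _ /=.
  have lt_p : a + i < N by lia.
  have lt_q : (a + i).+1 < N by lia.
  (* Letter [i] is the sign of the member with [a + i + 1] nonzero coordinates, the only one this
     swap changes. *)
  set p := Ordinal lt_p; set q := Ordinal lt_q.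
  apply/negbTE; apply: (@even_card_involution _ _ (fswap p q)).
  - move=> F; rewrite !inE => /andP[SF /eqP <-]; rewrite S_swap //=; try lia.
    apply/eqP; rewrite !del_word ?ltnS 1?ltnW //.
    by congr (_ ++ _); apply: eq_word => k k_int; rewrite fvec_swap //=; lia.
  - by move=> F _; rewrite fswapK.
  - by move=> F _; apply: fswap_neq; rewrite -val_eqE /=; lia.
rewrite -E; under eq_bigr => i _ do rewrite cA.
rewrite exchange_big /= (big_morph odd oddD (erefl : odd 0 = false)).
rewrite (eq_bigr _ (fun F _ => odd_del_altw true (size_word a m.+1 F))).
by rewrite big_split /= !odd_addb.
Qed.

End Words.
End Flags.

Definition svopp n (x : signvec n) : signvec n := [ffun i => omap negb (x i)].
Definition sv0 n : signvec n := [ffun=> None].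

Lemma svoppK n : involutive (@svopp n).
Proof. by move=> x; apply/ffunP=> i; rewrite !ffunE; case: (x i) => //= b; rewrite negbK. Qed.

Lemma in_sep (T : finType) (S : {set T}) (P : pred T) x :
  (x \in [set y in S | P y]) = (x \in S) && P x.
Proof. by rewrite in_set. Qed.

(** * Fan's theorem and oppositely alternating flags *)

Section Fan.
Variables (N : nat) (sg : signvec N -> bool).
Hypothesis sgN : forall x, x != sv0 N -> sg (svopp x) = ~~ sg x.

Implicit Types F : flag N.
Notation word := (word sg).

Lemma fvec_neq0 k F : 0 < k <= N -> fvec k F != sv0 N.
Proof.
move=> k_int; have N_gt0 : 0 < N by lia.
apply/eqP => /ffunP/(_ (F.1^-1 (Ordinal N_gt0))%g).
by rewrite !ffunE permKV /=; case: ifP => //; lia.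
Qed.

(* The flags of the subsphere spanned by the first [k] coordinates, completed
   in a fixed way to flags of the whole sphere. *)
Definition base_flags k : {set flag N} :=
  [set F : flag N | [forall i : 'I_N, (k <= i) ==> (F.1 i == i) && F.2 i]].

Lemma base_flagsP k F :
  reflect (forall i : 'I_N, k <= i -> F.1 i = i /\ F.2 i) (F \in base_flags k).
Proof.
rewrite inE; apply: (iffP forallP) => H i.
  by move=> ki; have /implyP/(_ ki)/andP[/eqP] := H i.
by apply/implyP => /H[-> ->]; rewrite eqxx.
Qed.

Lemma base_flags_lt k F (i : 'I_N) : F \in base_flags k -> (F.1 i < k) = (i < k).
Proof.
move/base_flagsP=> FP; rewrite !ltnNge; congr (~~ _).
apply/idP/idP => [ki|ki]; last by have [->] := FP _ ki.
by have [/perm_inj Fi _] := FP _ ki; rewrite -Fi.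
Qed.

(** The antipodal map of the subsphere of [base_flags k]; the signs of the fixed completion stay. *)
Definition fopp (k : nat) F : flag N := (F.1, [ffun i => F.2 i (+) (i < k)]).

Lemma foppK k : involutive (fopp k).
Proof.
by case=> s e; congr (_, _); apply/ffunP=> i; rewrite !ffunE /= -addbA addbb addbF.
Qed.

Lemma fopp_base k F : F \in base_flags k -> fopp k F \in base_flags k.
Proof.
move/base_flagsP=> FP; apply/base_flagsP => i ki; rewrite /= ffunE.
by rewrite ltnNge ki addbF; apply: FP.
Qed.

Lemma fopp_baseE k F : (fopp k F \in base_flags k) = (F \in base_flags k).
Proof. by apply/idP/idP => /fopp_base; rewrite ?foppK. Qed.

Lemma word_fopp k F : k <= N -> F \in base_flags k ->
  word 0 k (fopp k F) = map negb (word 0 k F).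
Proof.
move=> kN Fk; rewrite /word -map_comp; apply/eq_in_map => r; rewrite mem_iota /=.
case/andP=> r_gt0 r_k; rewrite -sgN; last by rewrite fvec_neq0 // r_gt0 (leq_trans _ kN).
congr sg; apply/ffunP=> i; rewrite !ffunE /=; case: ifP => //= i_r.
by rewrite -(base_flags_lt _ Fk) (leq_trans i_r) // addbT.
Qed.

Lemma word_fopp_alt b k F : k <= N -> F \in base_flags k ->
  (word 0 k (fopp k F) == altw b k) = (word 0 k F == altw (~~ b) k).
Proof.
move=> kN Fk; rewrite word_fopp // -(inj_eq (inj_map negb_inj)) -map_comp.
by rewrite (eq_map negbK) map_id map_negb_altw.
Qed.

(** Induction on [k]: modulo 2, the count on the sphere passes to the hemisphere [S] where the new
    coordinate is +, then to the flags of [S] that alternate before the last step, then to the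
    equator. *)
Lemma fan_odd k : k <= N ->
  odd #|[set F in base_flags k | word 0 k F == altw true k]|.
Proof.
elim: k => [_|k IH lt_kN].
  suff -> : [set F in base_flags 0 | word 0 0 F == altw true 0]
          = [set (1%g, [ffun=> true])] by rewrite cards1.
  apply/setP => -[s e]; rewrite inE [_ == altw true 0]eqxx andbT in_set1.
  apply/base_flagsP/eqP => [FP|[-> ->] i _]; last by rewrite ffunE perm1.
  congr (_, _); first by apply/permP => i; rewrite perm1; case: (FP i isT).
  by apply/ffunP => i; rewrite ffunE; case: (FP i isT).
pose o := Ordinal lt_kN.
pose S := [set F in base_flags k.+1 | F.2 o].
have inS F : (F \in S) = (F \in base_flags k.+1) && F.2 o by exact: in_sep.
have swapS (p q : 'I_N) : 0 <= p -> q = p.+1 :> nat -> q <= 0 + k ->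
    {in S, forall F, fswap p q F \in S}.
  move=> _ qE q_k F; rewrite !inS => /andP[/base_flagsP FP ->]; rewrite andbT.
  apply/base_flagsP => i ki; have [Fi ei] := FP i ki; split=> //.
  by rewrite permM Fi tpermD // -val_eqE /=; lia.
have := @odd_alt_words N sg 0 k S lt_kN swapS.
set Ap := [set F in S | _ == altw true k.+1].
set Am := [set F in S | _ == altw false k.+1].
set A := [set F in base_flags k.+1 | _].
(* The antipodal map exchanges the hemispheres and negates the words. *)
have -> : #|Am| = #|A :\: S|.
  rewrite -(card_preimset _ (inv_inj (foppK k.+1))); apply: eq_card => F.
  rewrite in_set in_sep in_setD [F \in A]in_sep !inS fopp_baseE [(fopp _ _).2 _]ffunE.
  rewrite ltnSn addbT.
  have [Fk|] := boolP (F \in base_flags k.+1); last by rewrite andbF.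
  by rewrite word_fopp_alt.
have -> : Ap = A :&: S.
  apply/setP => F; rewrite in_setI !in_sep.
  by rewrite andbACA andbb andbA andbAC.
rewrite -oddD cardsID => ->.
set B := [set F in S | _].
pose C : {set flag N} := [set F : flag N | F.1 o == o].
have inC F : (F \in C) = (F.1 o == o) by rewrite in_set.
(* If [o] is not the coordinate added last, the sign taken at the last step is free, and no counted
   letter sees it. *)
have even_B : ~~ odd #|B :\: C|.
  apply: (@even_card_involution _ _ (fflip o)) => [F|F _|F _].
  - rewrite !in_setD !in_sep !inC => /andP[Fo /andP[/andP[Fk Foo] /eqP wF]].
    rewrite -[(fflip o F).1]/(F.1) Fo [(fflip o F).2 _]ffunE (negbTE Fo) addbF Foo.
    rewrite andTb andbT; apply/andP; split.
      apply/base_flagsP => i ki; have /base_flagsP/(_ _ ki)[Fi ei] := Fk.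
      rewrite /= ffunE ei Fi; split=> //; rewrite -val_eqE /=.
      by have -> : i == k :> nat = false by lia.
    by rewrite -wF; apply/eqP/eq_word => r r_int; rewrite fvec_flip //=; lia.
  - exact: fflipK.
  - exact: fflip_neq.
rewrite -(cardsID C B) oddD (negbTE even_B) addbF.
suff -> : B :&: C = [set F in base_flags k | word 0 k F == altw true k].
  by apply: IH; lia.
apply/setP => F; rewrite in_setI !in_sep inC andbAC; congr (_ && _).
apply/andP/base_flagsP => [[/andP[/base_flagsP FP Foo] /eqP Fo] i|FP].
  by rewrite leq_eqVlt => /orP[/eqP ki|/FP//]; have -> : i = o by apply: val_inj.
have [Fo Foo] := FP o (leqnn k); rewrite Fo Foo eqxx andbT; split=> //.
by apply/base_flagsP => i ki; apply/FP/ltnW.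
Qed.

(* Some vector [z] of support size [a] lies on two flags whose signs alternate
   from there on, but oppositely: by Fan's lemma the alternating flags through
   some [z] are odd in number, and by [odd_alt_words] so are those with all
   signs reversed after [z]. *)
Lemma fan_pair a m : a + m.+1 = N ->
  exists F F' : flag N,
    [/\ fvec a F = fvec a F', word 0 N F = altw true N
      & word a m.+1 F' = altw (odd a) m.+1].
Proof.
move=> aN; pose A := [set F in base_flags N | word 0 N F == altw true N].
have AE : A = [set F : flag N | word 0 N F == altw true N].
  apply/setP => F; rewrite in_sep in_set andb_idl // => _.
  by apply/base_flagsP => i; rewrite leqNgt ltn_ord.
have odd_A : odd #|A| by apply: fan_odd.
have wN F r : r = a + m.+1 -> (word 0 r F == altw true r) =
    (word 0 a F == altw true a) && (word a m.+1 F == altw (~~ odd a) m.+1).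
  by move=> ->; rewrite word_cat altwD eqseq_cat ?size_word ?size_altw.
pose S (z : signvec N) := [set F : flag N | (fvec a F == z) && (word 0 a F == altw true a)].
have /existsP[z odd_z] : [exists z, odd #|[set F in S z | word a m.+1 F == altw (~~ odd a) m.+1]|].
  apply: contraLR odd_A => /existsPn even_z.
  rewrite AE -sum1dep_card (partition_big (fvec a) predT) //=.
  rewrite (big_morph odd oddD (erefl : odd 0 = false)) big1 // => z _.
  rewrite sum1dep_card -(negbTE (even_z z)); congr odd; apply: eq_card => F.
  rewrite in_sep !in_set wN //.
  by rewrite andbC andbA.
have lt_am : a + m < N by lia.
have S_step (G : flag N -> flag N) :
    (forall k F, k <= a -> fvec k (G F) = fvec k F) ->
  forall F, F \in S z -> G F \in S z.
  move=> GE F; rewrite !in_set GE // => /andP[-> /eqP <-] /=.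
  by apply/eqP/eq_word => k k_a; rewrite GE //; lia.
have S_swap (p q : 'I_N) : a <= p -> q = p.+1 :> nat -> q <= a + m ->
    {in S z, forall F, fswap p q F \in S z}.
  by move=> ap qE _; apply: S_step => k F ka; rewrite fvec_swap //; lia.
have := odd_alt_words sg lt_am S_swap.
(* The sign taken at the last step affects only the full vector, which [word a m] omits. *)
have /negbTE -> : ~~ odd #|[set F in S z | word a m F == altw true m]|.
  pose p := Ordinal lt_am.
  apply: (@even_card_involution _ _ (fflip p)) => [F|F _|F _].
  - rewrite !in_sep => /andP[SF /eqP <-]; apply/andP; split.
      by apply: S_step SF => k {}F ka; rewrite fvec_flip //=; lia.
    by apply/eqP/eq_word => k k_int; rewrite fvec_flip //=; lia.
  - exact: fflipK.
  - exact: fflip_neq.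
have pick (b : bool) : odd #|[set F in S z | word a m.+1 F == altw b m.+1]| ->
    exists2 F, F \in S z & word a m.+1 F = altw b m.+1.
  move=> odd_b; case: (set_0Vmem [set F in S z | word a m.+1 F == altw b m.+1]).
    by move=> b0; rewrite b0 cards0 in odd_b.
  by case=> F; rewrite in_sep => /andP[SF /eqP wF]; exists F.
move=> par; have {par} : odd #|[set F in S z | word a m.+1 F == altw (odd a) m.+1]|.
  by move: par odd_z; case: (odd a) => /=; do 2!case: (odd _).
case/pick=> F' + wF'; have [F + wF] := pick _ odd_z.
rewrite !in_set => /andP[/eqP Fz F_alt] /andP[/eqP F'z _].
by exists F, F'; split; rewrite ?Fz ?F'z //; apply/eqP; rewrite wN // F_alt wF eqxx.
Qed.
End Fan.

(** * Sign vectors and alternation numbers *)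

Section SignVectorOrder.
Variable n : nat.
Implicit Types (x y : signvec n) (b : bool) (I : {set 'I_n}).

Definition svle x y : Prop := forall i, x i != None -> y i = x i.

(** Convertible to [pos_part] or [neg_part], but uniform in the sign. *)
Definition side b x : {set 'I_n} := [set i | x i == Some b].

Definition svset x (u : 'I_n) b : signvec n :=
  [ffun i => if i == u then Some b else x i].

Lemma svopp_eq0 x : (svopp x == sv0 n) = (x == sv0 n).
Proof.
apply/eqP/eqP => [x0|->]; last by apply/ffunP => i; rewrite !ffunE.
by rewrite -(svoppK x) x0; apply/ffunP => i; rewrite !ffunE.
Qed.

Lemma side_opp b x : side b (svopp x) = side (~~ b) x.
Proof. by apply/setP => i; rewrite !inE ffunE; case: (x i) b => [[]|] []. Qed.

Lemma svle_side x y b : svle x y -> side b x \subset side b y.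
Proof. by move=> xy; apply/subsetP => i; rewrite !inE => /eqP xi; rewrite xy xi. Qed.

Lemma svle_set x u b : x u = None -> svle x (svset x u b).
Proof. by move=> xu i; rewrite ffunE; case: (eqVneq i u) => [->|]; rewrite ?xu. Qed.

Lemma svle_svset x y u b : svle x y -> svle (svset x u b) (svset y u b).
Proof. by move=> xy i; rewrite !ffunE; case: (i == u) => //; apply: xy. Qed.

Lemma side_set_neq b x u : x u = None -> side (~~ b) (svset x u b) = side (~~ b) x.
Proof.
move=> xu; apply/setP => i; rewrite !inE ffunE.
by case: (eqVneq i u) => [->|//]; rewrite xu; case: b.
Qed.

Lemma supp_size_set x u b : x u = None -> supp_size (svset x u b) = (supp_size x).+1.
Proof.
move=> xu; rewrite /supp_size (cardsD1 u) inE ffunE eqxx add1n; congr _.+1.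
apply: eq_card => i; rewrite !inE ffunE.
by have [->|] := eqVneq i u; rewrite //= xu.
Qed.

Lemma supp_size_le x : supp_size x <= n.
Proof. by rewrite -[X in _ <= X]card_ord max_card. Qed.

Lemma supp_size_full x i : supp_size x = n -> x i != None.
Proof.
move=> x_n; have : [set i | x i != None] == [set: 'I_n].
  by rewrite eqEcard subsetT cardsT card_ord; rewrite /supp_size in x_n; rewrite x_n /=.
by move/eqP/setP/(_ i); rewrite !inE.
Qed.

Lemma supp_size0 : supp_size (sv0 n) = 0.
Proof.
by apply/eqP; rewrite cards_eq0; apply/eqP/setP => i; rewrite !inE ffunE.
Qed.

Lemma leq_alt x I : alternating [seq x i | i <- enum I] -> #|I| <= alt x.
Proof. by move=> xI; apply: (@leq_bigmax_cond _ _ (fun J : {set 'I_n} => #|J|)). Qed.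

Lemma alt_attained x :
  exists2 I : {set 'I_n}, alternating [seq x i | i <- enum I] & alt x = #|I|.
Proof.
have [|I xI E] := @eq_bigmax_cond _
  [pred I : {set 'I_n} | alternating [seq x i | i <- enum I]]
  (fun I : {set 'I_n} => #|I|); last by exists I.
by apply/card_gt0P; exists set0; rewrite !inE enum_set0.
Qed.

Lemma alternating_supp x I i :
  alternating [seq x i | i <- enum I] -> i \in I -> x i != None.
Proof.
case/andP => /allP xI _ iI; have : x i \in [seq x i | i <- enum I].
  by apply: map_f; rewrite mem_enum.
by move/xI; case: (x i).
Qed.

Lemma svle_alternating x y I : svle x y ->
  alternating [seq x i | i <- enum I] ->
  [seq y i | i <- enum I] = [seq x i | i <- enum I].
Proof.
move=> xy xI; apply/eq_in_map => i; rewrite mem_enum => /(alternating_supp xI).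
exact: xy.
Qed.

Lemma svle_alt x y : svle x y -> alt x <= alt y.
Proof.
move=> xy; have [I xI ->] := alt_attained x.
by apply: leq_alt; rewrite (svle_alternating xy xI).
Qed.

Lemma alt_le_supp x : alt x <= supp_size x.
Proof.
have [I xI ->] := alt_attained x; apply/subset_leq_card/subsetP => i /(alternating_supp xI).
by rewrite inE.
Qed.

Lemma enum_set_sorted I : sorted (relpre val ltn) (enum I).
Proof.
rewrite {1}/enum_mem; apply: sorted_filter; first by move=> ? ? ?; apply: ltn_trans.
by rewrite -enumT -sorted_map val_enum_ord iota_ltn_sorted.
Qed.

Lemma enum_setU1 (k : 'I_n) I : (forall l, l \in I -> k < l) ->
  enum (k |: I) = k :: enum I.
Proof.
move=> kI; apply: (@irr_sorted_eq _ (relpre val ltn)).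
- by move=> ? ? ?; apply: ltn_trans.
- by move=> i /=; rewrite ltnn.
- exact: enum_set_sorted.
- rewrite /= path_sortedE; last by move=> ? ? ?; apply: ltn_trans.
  by rewrite enum_set_sorted andbT; apply/allP => l; rewrite mem_enum => /kI.
- by move=> l; rewrite mem_enum !inE mem_enum.
Qed.

Lemma alt_prepend x I (k : 'I_n) :
    alternating (x k :: [seq x i | i <- enum I]) ->
    (forall l, l \in I -> k < l) ->
  #|I| < alt x.
Proof.
move=> xI kI; have kNI : k \notin I by apply/negP => /kI; rewrite ltnn.
by rewrite -add1n -[1 + _]/(true + _) -{1}kNI -cardsU1 leq_alt // enum_setU1.
Qed.

Definition first_nonzero x i : bool :=
  (x i != None) && [forall j : 'I_n, (j < i) ==> (x j == None)].

Definition first_sign x : bool :=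
  if [pick i | first_nonzero x i] is Some i then x i == Some true else false.

Lemma first_signP x : x != sv0 n ->
  exists2 i, first_nonzero x i & x i = Some (first_sign x).
Proof.
move=> x_neq0; rewrite /first_sign; case: pickP => [i xi|no_first].
  by exists i => //; case/andP: xi; case: (x i) => [[]|].
case/negP: x_neq0; apply/eqP/ffunP => i; rewrite ffunE.
apply/eqP/negPn/negP => xi.
have [j xj j_min] := @arg_minnP _ i (fun i => x i != None) val xi.
have /negP[] := no_first j; rewrite /first_nonzero xj; apply/forallP => k.
by apply/implyP => kj; apply/negPn/negP => /j_min; rewrite /= leqNgt kj.
Qed.

Lemma first_sign_opp x : x != sv0 n -> first_sign (svopp x) = ~~ first_sign x.
Proof.
move=> x0; have x0' : svopp x != sv0 n by rewrite svopp_eq0.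
have [i /andP[_ /forallP xi] xiE] := first_signP x0.
have [j /andP[_ /forallP xj] xjE] := first_signP x0'.
have oppE k : (svopp x) k = omap negb (x k) by rewrite ffunE.
have ij : i = j.
  case: (ltngtP i j) => [|/(implyP (xi j))/eqP xj0|/ord_inj//].
    by move/(implyP (xj i)); rewrite oppE xiE.
  by move: xjE; rewrite oppE xj0.
by move: xjE; rewrite -ij oppE xiE => -[].
Qed.

(* If the first sign changed, a longest alternating subsequence of [x] could be
   prolonged to the left in [y]. *)
Lemma svle_first_sign x y :
  svle x y -> x != sv0 n -> alt x = alt y -> first_sign x = first_sign y.
Proof.
move=> xy x0 alt_xy.
have [i /andP[xi0 /forallP xi] xiE] := first_signP x0.
have y0 : y != sv0 n.
  by apply: contraNneq xi0 => y0; rewrite -(xy i) ?xiE // y0 ffunE.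
have [j /andP[yj0 /forallP yj] yjE] := first_signP y0.
have yiE : y i = Some (first_sign x) by rewrite xy.
have [ij|] := leqP i j.
  have : ~~ (i < j) by apply/negP => /(implyP (yj i)); rewrite yiE.
  rewrite -leqNgt => ji; have ij' : i = j by apply/ord_inj/anti_leq; rewrite ij.
  by move: yjE; rewrite -ij' yiE => -[].
move=> lt_ji; apply/eqP/negPn/negP => sxy.
have [I xI alt_x] := alt_attained x.
have iI l : l \in I -> i <= l.
  move/(alternating_supp xI); apply: contraR; rewrite -ltnNge.
  by move/(implyP (xi l)).
have yI := svle_alternating xy xI.
(* The longest alternating subsequence can be prolonged in every case: by [j] in [y] if it begins
   with the first sign of [x], by [i] in [x] otherwise. *)
case E : (enum I) => [|l0 L].
  have I0 : I = set0 by apply/setP => l; rewrite -mem_enum E !inE.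
  have : #|I| < alt x; last by rewrite alt_x ltnn.
  apply: (@alt_prepend x I i); first by rewrite E /alternating /= andbT; case: (x i) xi0.
  by move=> l; rewrite I0 inE.
have l0I : l0 \in I by rewrite -mem_enum E mem_head.
have [xl0|xl0] := eqVneq (x l0) (x i).
  have : #|I| < alt y; last by rewrite -alt_xy alt_x ltnn.
  apply: (@alt_prepend y I j); last by move=> l /iI; apply: leq_trans.
  move: xI; rewrite yI E /alternating /= => /andP[-> ->]; rewrite xl0 xiE yjE /= andbT.
  by apply: contra sxy => /eqP[->].
have : #|I| < alt x; last by rewrite alt_x ltnn.
apply: (@alt_prepend x I i).
  by move: xI; rewrite E /alternating /= => /andP[-> ->]; rewrite xiE /= -xiE eq_sym xl0.
have := enum_set_sorted I; rewrite E /= path_sortedE; last by move=> ? ? ?; apply: ltn_trans.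
case/andP => /allP l0L _ l; rewrite -mem_enum E inE => /predU1P[->|/l0L /=].
  by rewrite ltn_neqAle iI // andbT; apply: contraNneq xl0 => /val_inj->.
by apply: leq_ltn_trans; apply: iI.
Qed.

Lemma alt_gt0 x : x != sv0 n -> 0 < alt x.
Proof.
move=> /first_signP[i _ xi]; have : #|[set i]| <= alt x; last by rewrite cards1.
by apply: leq_alt; rewrite enum_set1 /alternating /= xi.
Qed.

End SignVectorOrder.

(** * Labels of a single nice hypergraph *)

Section MaxColor.
Variables (G : graph) (k : nat) (c : G -> 'I_k).
Implicit Types (P Q : pred G).

(* Colors are counted from 1 here, so that 0 means that [P] is empty. *)
Definition maxcol P : nat := \max_(v | P v) (c v).+1.

Lemma maxcol_le P : maxcol P <= k.
Proof. by apply/bigmax_leqP => v _. Qed.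

Lemma ltn_maxcol P v : P v -> c v < maxcol P.
Proof. exact: (@leq_bigmax_cond _ P (fun v => (c v).+1)). Qed.

Lemma maxcol_attained P : 0 < maxcol P -> exists2 v, P v & maxcol P = (c v).+1.
Proof.
have [/card_gt0P P_gt0 _|] := ltnP 0 #|P|.
  have [|v Pv E] := @eq_bigmax_cond _ P (fun v => (c v).+1); last by exists v.
  exact/card_gt0P.
by rewrite leqn0 => /eqP/card0_eq P0; rewrite /maxcol big_pred0.
Qed.

Lemma maxcol_sub P Q : (forall v, P v -> Q v) -> maxcol P <= maxcol Q.
Proof. by move=> PQ; apply/bigmax_leqP => v /PQ; apply: ltn_maxcol. Qed.

(** Equal maxima would be attained at adjacent vertices of equal color. *)
Lemma maxcol_neq P Q : proper_coloring c ->
    (forall u v, P u -> Q v -> adj u v) -> 0 < maxcol P ->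
  maxcol P != maxcol Q.
Proof.
move=> /forallP c_proper PQ P_gt0; have [u Pu uE] := maxcol_attained P_gt0.
apply/eqP => PQE; have := P_gt0; rewrite PQE => /maxcol_attained[v Qv vE].
have /forallP/(_ v)/implyP/(_ (PQ _ _ Pu Qv)) := c_proper u.
by rewrite -val_eqE -eqSS -uE -vE PQE eqxx.
Qed.

End MaxColor.

Lemma side_disjoint n (x : signvec n) b : [disjoint side b x & side (~~ b) x].
Proof.
rewrite -setI_eq0; apply/eqP/setP => i; rewrite !inE.
by case: (x i) => [d|//]; rewrite andbC; case: b d => [] [].
Qed.

Lemma set1_in_hedges (H : hypergraph) (e : {set hvertex H}) v :
  e \in hedges H -> e \subset [set v] -> [set v] \in hedges H.
Proof.
move=> eH; rewrite subset1 => /orP[/eqP <- //|/eqP e0].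
by have := hedges_neq0 H; rewrite -e0 eH.
Qed.

Section Block.
Variables (H : hypergraph) (sigma : 'I_#|hvertex H| -> hvertex H).
Variables (k : nat) (c : KG H -> 'I_k).
Let n := #|hvertex H|.
Let a := alt_sigma sigma.

Implicit Types (x y : signvec n) (b : bool).

Definition on_side b x : pred (KG H) := fun e => val e \subset sigma @: side b x.

Definition side_col b x : nat := maxcol c (on_side b x).

(** Edge-free vectors get at most [a], one-sided ones [a + 1], and two-sided ones at least [a + 2]
    when [c] is proper and [sigma] injective, since then the colors of the two sides, counted from
    1, differ. *)
Definition block_label x : nat :=
  if (side_col true x == 0) && (side_col false x == 0) then alt x
  else if (side_col true x == 0) || (side_col false x == 0) then a.+1
  else a + maxn (side_col true x) (side_col false x).

(** An edge-free side has color 0, so one comparison serves the one-sided and the two-sided case. *)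
Definition block_sign x : bool :=
  if (side_col true x == 0) && (side_col false x == 0) then first_sign x
  else side_col false x < side_col true x.

Lemma svle_on_side b x y e : svle x y -> on_side b x e -> on_side b y e.
Proof. by move=> xy /subset_trans; apply; apply: imsetS; apply: svle_side. Qed.

Lemma svle_side_col b x y : svle x y -> side_col b x <= side_col b y.
Proof. by move=> xy; apply: maxcol_sub => e; apply: svle_on_side. Qed.

Lemma side_col_opp b x : side_col b (svopp x) = side_col (~~ b) x.
Proof. by rewrite /side_col /on_side side_opp. Qed.

Lemma contains_edgeE b x : contains_edge (sigma @: side b x) = (0 < side_col b x).
Proof.
apply/existsP/idP => [[e /andP[eH ex]]|/maxcol_attained[e ex _]].
  by apply: leq_trans (@ltn_maxcol _ _ c (on_side b x) (exist _ e eH) ex).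
by exists (val e); rewrite (valP e).
Qed.

Lemma side_col0 b : side_col b (sv0 n) = 0.
Proof.
apply/eqP; rewrite -leqn0 leqNgt -contains_edgeE; apply/existsP => -[e /andP[eH]].
have -> : side b (sv0 n) = set0 by apply/setP => i; rewrite !inE ffunE.
rewrite imset0 subset0 => /eqP e0; have := hedges_neq0 H.
by rewrite -e0 eH.
Qed.

Lemma alt_le_alt_sigma x :
  side_col true x = 0 -> side_col false x = 0 -> alt x <= a.
Proof.
move=> x1 x2; apply: (@leq_bigmax_cond _ _ (@alt n)).
by rewrite !(contains_edgeE true, contains_edgeE false) x1 x2.
Qed.

Lemma svle_block_label x y : svle x y -> block_label x <= block_label y.
Proof.
move=> xy; have := svle_side_col true xy; have := svle_side_col false xy.
have := @alt_le_alt_sigma x; have := svle_alt xy; rewrite /block_label.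
by do !case: ifP; lia.
Qed.

Lemma block_label0 : block_label (sv0 n) = 0.
Proof.
rewrite /block_label !side_col0 /=; apply/eqP; rewrite -leqn0.
by rewrite -(supp_size0 n) alt_le_supp.
Qed.

Lemma block_label_gt0 x : x != sv0 n -> 0 < block_label x.
Proof. by move=> /alt_gt0; rewrite /block_label; do !case: ifP; lia. Qed.

Hypothesis nE : n = a + k.

Lemma block_label_le x : block_label x <= n.
Proof.
have := maxcol_le c (on_side true x); have := maxcol_le c (on_side false x).
rewrite /block_label -!/(side_col _ x) => le1 le2.
case: ifP => [/andP[/eqP x1 /eqP x2]|x12].
  by have := alt_le_alt_sigma x1 x2; lia.
by case: ifP; lia.
Qed.

Hypothesis sigma_inj : injective sigma.
Hypothesis c_proper : proper_coloring c.

Lemma on_side_adj b x e f : on_side b x e -> on_side (~~ b) x f -> adj e f.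
Proof.
move=> ex fx; apply: disjointWl ex _; apply: disjointWr fx _.
by rewrite imset_disjoint ?side_disjoint //; move=> u v _ _; apply: sigma_inj.
Qed.

Lemma side_col_neq x : 0 < side_col true x -> side_col true x != side_col false x.
Proof.
apply: (maxcol_neq c_proper) => e f; exact: (@on_side_adj true).
Qed.

Lemma block_sign_opp x : x != sv0 n -> block_sign (svopp x) = ~~ block_sign x.
Proof.
move=> x0; rewrite /block_sign !side_col_opp first_sign_opp // andbC.
case: ifP => // x12; have := @side_col_neq x.
rewrite /= -leqNgt => col_neq; rewrite /= in x12; apply/idP/idP; lia.
Qed.

(** Equal labels put [x] and [y] in the same case. Edge-free vectors are settled by
    [svle_first_sign]; otherwise side colors only grow, so an equal maximum stays on its side. *)
Lemma svle_block_sign x y : svle x y -> x != sv0 n ->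
  block_label x = block_label y -> block_sign x = block_sign y.
Proof.
move=> xy x0; have := svle_side_col true xy; have := svle_side_col false xy.
have := @alt_le_alt_sigma x; have := svle_first_sign xy x0.
have := @side_col_neq x; have := @side_col_neq y.
rewrite /block_label /block_sign.
case: (boolP ((side_col true x == 0) && (side_col false x == 0))) => x12;
  case: (boolP ((side_col true y == 0) && (side_col false y == 0))) => y12.
- by move=> _ _ first_xy *; apply: first_xy.
- by do !case: ifP; move=> *; exfalso; lia.
- by do !case: ifP; move=> *; exfalso; lia.
- by do !case: ifP; move=> *; apply/idP/idP; lia.
Qed.

Hypothesis no_singleton : forall v : hvertex H, [set v] \notin hedges H.
Hypothesis alt_sigma_edge : forall x : signvec n,
  a <= alt x -> a < supp_size x ->
  contains_edge (sigma @: pos_part x) || contains_edge (sigma @: neg_part x).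

(** The two sides meet only in [u], so a common edge would be a singleton. *)
Lemma on_side_set_neq x u e f :
    x u = None -> on_side true (svset x u true) e ->
    on_side false (svset x u false) f ->
  e != f.
Proof.
move=> xu eu; apply: contraTneq => <-; apply/negP => eu'.
have /negP[] := no_singleton (sigma u); apply: (set1_in_hedges (valP e)).
apply/subsetP => p pe; have /imsetP[q qi pE] := subsetP eu _ pe.
have /imsetP[q' q'i pE'] := subsetP eu' _ pe.
have qq' : q = q' by apply: sigma_inj; rewrite -pE.
move: qi q'i; rewrite -qq' pE !inE !ffunE.
by case: (eqVneq q u) => [->|_] /=; rewrite ?eqxx // => /eqP -> /eqP.
Qed.

Lemma on_side_set_common b x u u' e :
    u != u' -> on_side b (svset x u b) e -> on_side b (svset x u' b) e ->
  on_side b x e.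
Proof.
move=> uu' eu eu'; apply/subsetP => p pe.
have /imsetP[q qi pE] := subsetP eu _ pe; have /imsetP[q' q'i pE'] := subsetP eu' _ pe.
have qq' : q = q' by apply: sigma_inj; rewrite -pE.
rewrite pE imset_f //; move: qi q'i; rewrite -qq' !inE !ffunE.
by case: (eqVneq q u) => [->|_ //]; rewrite (negbTE uu').
Qed.

(** Both extensions lie below the vector that takes [b] at [u] and the other sign at [u'], and its
    two sides are disjoint. *)
Lemma on_side_set_adj b x u u' e f :
    x u = None -> x u' = None -> u != u' ->
    on_side b (svset x u b) e -> on_side (~~ b) (svset x u' (~~ b)) f ->
  adj e f.
Proof.
move=> xu xu' uu' eu fu'.
have yE : svset (svset x u b) u' (~~ b) = svset (svset x u' (~~ b)) u b.
  apply/ffunP => i; rewrite !ffunE; have [->|//] := eqVneq i u'.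
  by rewrite eq_sym (negbTE uu').
apply: (@on_side_adj b (svset (svset x u b) u' (~~ b))).
  by apply: svle_on_side eu; apply: svle_set; rewrite ffunE eq_sym (negbTE uu').
by rewrite yE; apply: svle_on_side fu'; apply: svle_set; rewrite ffunE (negbTE uu').
Qed.

(** The new coordinate pushes the support above [a], so niceness gives an edge; the side opposite to
    [b] is unchanged and edge-free. *)
Lemma block_extends b x u :
    side_col true x = 0 -> side_col false x = 0 -> a <= alt x -> x u = None ->
  0 < side_col b (svset x u b).
Proof.
move=> x1 x2 alt_le xu; rewrite -contains_edgeE.
have := alt_sigma_edge (x := svset x u b).
rewrite supp_size_set // ltnS (leq_trans alt_le (alt_le_supp _)).
rewrite (leq_trans alt_le (svle_alt (svle_set b xu))) => /(_ isT isT).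
have : ~~ contains_edge (sigma @: side (~~ b) (svset x u b)).
  by rewrite side_set_neq // contains_edgeE; case: (b); rewrite ?x1 ?x2.
by case: (b) => /negbTE; rewrite /side /pos_part /neg_part => ->; rewrite ?orbF.
Qed.

(** A vector attaining [alt_sigma] works: by niceness, a support larger than [a] would contain an
    edge on one side. *)
Lemma block_witness : exists x,
  [/\ side_col true x = 0, side_col false x = 0, alt x = a & supp_size x = a].
Proof.
have [|x x_free alt_x] := @eq_bigmax_cond _
  [pred x : signvec n | ~~ contains_edge (sigma @: pos_part x)
                        && ~~ contains_edge (sigma @: neg_part x)] (@alt n).
  apply/card_gt0P; exists (sv0 n).
  by rewrite inE !(contains_edgeE true, contains_edgeE false) !side_col0.
have x12 := x_free; rewrite inE !(contains_edgeE true, contains_edgeE false) in x12.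
have alt_xa : alt x = a by [].
move: x12; rewrite -!leqNgt !leqn0 => /andP[/eqP x1 /eqP x2]; exists x; split=> //.
apply/eqP; rewrite eqn_leq -{2}alt_xa alt_le_supp andbT leqNgt; apply/negP => a_lt.
have := alt_sigma_edge _ a_lt; rewrite alt_xa => /(_ (leqnn _)).
by rewrite !(contains_edgeE true, contains_edgeE false) x1 x2.
Qed.

Lemma card_unset x : supp_size x = a -> #|[set u | x u == None]| = k.
Proof.
move=> x_a; have := cardsC [set u | x u != None].
rewrite card_ord -/(supp_size x) x_a => a_n.
have /addnI <- := etrans a_n nE.
by apply: eq_card => u; rewrite !inE negbK.
Qed.

Lemma block_edge_pair : 0 < k -> exists e f : KG H, e != f.
Proof.
have [x [x1 x2 alt_x supp_x]] := block_witness.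
rewrite -(card_unset supp_x) => /card_gt0P[u]; rewrite inE => /eqP xu.
have ext b : exists e, on_side b (svset x u b) e.
  have /maxcol_attained[e] := block_extends b x1 x2 (eq_leq (esym alt_x)) xu.
  by exists e.
have [[e eu] [f fu]] := (ext true, ext false).
by exists e, f; apply: on_side_set_neq eu fu.
Qed.

(** The witness is extended at two free coordinates, with + for [e1], [e2] and with - for [f1],
    [f2]. An edge common to two extensions of the same sign would already lie on a side of the
    edge-free witness. *)
Lemma block_edge_quad : 1 < k -> exists e1 e2 f1 f2 : KG H,
  [/\ adj e1 f2, adj e2 f1, e1 != f1 & e2 != f2] /\ e1 != e2 /\ f1 != f2.
Proof.
have [x [x1 x2 alt_x supp_x]] := block_witness.
rewrite -(card_unset supp_x) => /card_gt1P[u [u' []]]; rewrite !inE => /eqP xu /eqP xu' uu'.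
have ext b v : x v = None -> exists e, on_side b (svset x v b) e.
  move=> xv; have /maxcol_attained[e] := block_extends b x1 x2 (eq_leq (esym alt_x)) xv.
  by exists e.
have [[e1 e1u] [e2 e2u]] := (ext true _ xu, ext true _ xu').
have [[f1 f1u] [f2 f2u]] := (ext false _ xu, ext false _ xu').
have free b e : ~ on_side b x e.
  move/(ltn_maxcol c); rewrite -/(side_col b x).
  by case: b; rewrite ?x1 ?x2.
exists e1, e2, f1, f2; split; last first.
  split; apply/eqP => ef.
    by apply: (free true e1); apply: on_side_set_common uu' e1u _; rewrite ef.
  by apply: (free false f1); apply: on_side_set_common uu' f1u _; rewrite ef.
split; try exact: on_side_set_neq e1u f1u; try exact: on_side_set_neq e2u f2u.
  exact: (@on_side_set_adj true _ _ _ _ _ xu xu').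
by rewrite eq_sym in uu'; exact: (@on_side_set_adj true _ _ _ _ _ xu' xu).
Qed.

End Block.

(** * Consecutive members of a flag *)

Lemma fvec_unset N k (F : flag N) (i : 'I_N) : k <= F.1 i -> fvec k F i = None.
Proof. by move=> ki; rewrite ffunE ltnNge ki. Qed.

Lemma fvecS N k (F : flag N) (p : 'I_N) : p = k :> nat ->
  fvec k.+1 F = svset (fvec k F) (F.1^-1 p)%g (F.2 (F.1^-1 p)%g).
Proof.
move=> pk; apply/ffunP => i; rewrite !ffunE ltnS leq_eqVlt -pk.
have [->|i_p] := eqVneq i (F.1^-1 p)%g; first by rewrite permKV eqxx.
suff /negbTE -> : F.1 i != p :> nat by [].
by apply: contraNneq i_p => /ord_inj <-; rewrite permK.
Qed.

Lemma svle_fvec N k m (F : flag N) : k <= m -> svle (fvec k F) (fvec m F).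
Proof.
by move=> km i; rewrite !ffunE; case: ifP => // ik _; rewrite (leq_trans ik km).
Qed.

(** Strict growth over [m] indices exhausts the [m] integers from [a + 1] to [a + m]. *)
Lemma increasing_squeeze (f : nat -> nat) a m :
    (forall i, i.+1 < m -> f i < f i.+1) -> a < f 0 ->
    (forall i, f i <= a + m) ->
  forall i, i < m -> f i = (a + i).+1.
Proof.
move=> f_incr f0 f_le i im.
have lower j : j < m -> a + j < f j.
  elim: j => [|j IH] jm; first by rewrite addn0.
  by rewrite addnS; apply: leq_ltn_trans (f_incr j jm); apply: IH; apply: ltnW.
have upper d : d < m -> f (m.-1 - d) + d <= a + m.
  elim: d => [|d IH] dm; first by rewrite addn0.
  have E : (m.-1 - d.+1).+1 = m.-1 - d by lia.
  have := f_incr (m.-1 - d.+1); rewrite E => /(_ _)H.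
  have : f (m.-1 - d.+1) < f (m.-1 - d) by apply: H; lia.
  have := IH (ltnW dm); lia.
have := lower i im; have := upper (m.-1 - i).
have -> : m.-1 - (m.-1 - i) = i by lia.
lia.
Qed.

(** * The product *)

Section Blocks.
Variables (s : nat) (n : 'I_s.+1 -> nat).

Definition coord : finType := {j : 'I_s.+1 & 'I_(n j)}.
Let N := #|{: coord}|.

(** Sign vectors are indexed by ordinals, hence [enum_rank]; alternation is only measured inside a
    block, in the order of that block. *)
Definition at_block (j : 'I_s.+1) (i : 'I_(n j)) : 'I_N :=
  enum_rank (Tagged (fun j => 'I_(n j)) i : coord).

Definition blk (x : signvec N) (j : 'I_s.+1) : signvec (n j) :=
  [ffun i => x (at_block i)].

Implicit Types (x y : signvec N) (b : bool).

Lemma card_coord : N = \sum_j n j.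
Proof. by rewrite /N card_tagged sumnE big_map enumT; apply: eq_bigr => j _; rewrite card_ord. Qed.

Lemma at_blockP (u : 'I_N) : exists j (i : 'I_(n j)), u = at_block i.
Proof.
exists (tag (enum_val u)), (tagged (enum_val u)).
by rewrite /at_block; case: (enum_val u) (enum_valK u).
Qed.

Lemma at_block_inj j : injective (@at_block j).
Proof. by move=> i i' /enum_rank_inj/eqP; rewrite eq_Tagged => /eqP. Qed.

Lemma at_block_neq j j' (i : 'I_(n j)) (i' : 'I_(n j')) :
  j != j' -> at_block i != at_block i'.
Proof.
move=> jj'; apply: contraNneq jj' => /enum_rank_inj E.
by apply/eqP; rewrite -[j]/(tag (Tagged (fun j => 'I_(n j)) i)) E.
Qed.

Lemma blk0 j : blk (sv0 N) j = sv0 (n j).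
Proof. by apply/ffunP => i; rewrite !ffunE. Qed.

Lemma blk_opp x j : blk (svopp x) j = svopp (blk x j).
Proof. by apply/ffunP => i; rewrite !ffunE. Qed.

Lemma blk_neq0 x : x != sv0 N -> exists j, blk x j != sv0 (n j).
Proof.
move=> x0; apply/existsP; apply: contraR x0 => /existsPn x0.
apply/eqP/ffunP => u; have [j [i ->]] := at_blockP u; rewrite ffunE.
by have /negPn/eqP/ffunP/(_ i) := x0 j; rewrite !ffunE.
Qed.

Lemma svle_blk x y j : svle x y -> svle (blk x j) (blk y j).
Proof. by move=> xy i; rewrite !ffunE; apply: xy. Qed.

Lemma blk_set x j (i : 'I_(n j)) b :
  blk (svset x (at_block i) b) j = svset (blk x j) i b.
Proof. by apply/ffunP => k; rewrite !ffunE (inj_eq (@at_block_inj j)). Qed.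

Lemma blk_set_neq x j (i : 'I_(n j)) b j' : j' != j ->
  blk (svset x (at_block i) b) j' = blk x j'.
Proof.
by move=> jj'; apply/ffunP => k; rewrite !ffunE (negbTE (at_block_neq _ _ jj')).
Qed.

Lemma blk_svset x j (i : 'I_(n j)) b j' :
  blk (svset x (at_block i) b) j' = blk x j' \/ exists i' : 'I_(n j'),
    at_block i = at_block i' /\ blk (svset x (at_block i) b) j' = svset (blk x j') i' b.
Proof.
have [->|j'j] := eqVneq j' j; last by left; rewrite blk_set_neq.
by right; exists i; rewrite blk_set.
Qed.

End Blocks.

Lemma leq_sum_eq (I : finType) (f g : I -> nat) :
  (forall i, f i <= g i) -> \sum_i f i = \sum_i g i -> f =1 g.
Proof.
move=> fg E; have /leqif_sum[_] : forall i, true -> f i <= g i ?= iff (f i == g i).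
  by move=> i _; apply/leqif_eq.
by rewrite E eqxx => /esym/forallP eq_fg i; apply/eqP/eq_fg.
Qed.

Lemma leq_sum1 (I : finType) (f : I -> nat) i : f i <= \sum_j f j.
Proof. by rewrite (bigD1 i) //= leq_addr. Qed.

Lemma leq_sum2 (I : finType) (f : I -> nat) i i' :
  i' != i -> f i + f i' <= \sum_j f j.
Proof. by move=> ii'; rewrite (bigD1 i) //= (bigD1 i') //= leq_add2l leq_addr. Qed.

Lemma sum_change (I : finType) (f g : I -> nat) i :
  (forall j, j != i -> f j = g j) -> \sum_j f j + g i = \sum_j g j + f i.
Proof. by move=> fg; rewrite (bigD1 i) // [in RHS](bigD1 i) //= (eq_bigr g fg); lia. Qed.

(** * Label and sign of a vector of the product *)

Section Product.
Variables (s : nat) (H : 'I_s.+1 -> hypergraph).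
Local Notation n := (fun j => #|hvertex (H j)|).
Local Notation nb j := #|hvertex (H j)|.
Local Notation N := #|{: coord n}|.
Variable sigma : forall j, 'I_(nb j) -> hvertex (H j).
Hypothesis sigma_inj : forall j, injective (@sigma j).
Variables (k : 'I_s.+1 -> nat) (cH : forall j, KG (H j) -> 'I_(k j)).
Hypothesis cH_proper : forall j, proper_coloring (@cH j).
Hypothesis nE : forall j, nb j = alt_sigma (@sigma j) + k j.
Hypothesis no_singleton : forall j (v : hvertex (H j)), [set v] \notin hedges (H j).
Hypothesis alt_sigma_edge : forall j (x : signvec (nb j)),
  alt_sigma (@sigma j) <= alt x -> alt_sigma (@sigma j) < supp_size x ->
  contains_edge (@sigma j @: pos_part x) || contains_edge (@sigma j @: neg_part x).

Local Notation G := (cat_prod (fun j => KG (H j))).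
Variables (t : nat) (c : G -> 'I_t).
Hypothesis c_proper : proper_coloring c.
Hypothesis t_k : forall j, t <= k j.
Hypothesis t_ge3 : 2 < t.

Implicit Types (x y : signvec N) (b : bool).

Local Notation scol j b x := (side_col (@sigma j) (@cH j) b (blk x j)).
Local Notation blabel x j := (block_label (@sigma j) (@cH j) (blk x j)).
Local Notation bsign x j := (block_sign (@sigma j) (@cH j) (blk x j)).

Definition on_sides b x : pred G :=
  fun v => [forall j, on_side (@sigma j) b (blk x j) (v j)].

Definition sides_col b x : nat := maxcol c (on_sides b x).

Definition label x : nat :=
  if (sides_col true x == 0) && (sides_col false x == 0)
  then \sum_j blabel x j
  else N - t + maxn (sides_col true x) (sides_col false x).

(** The default [true] is reached only at the zero vector. Which block is picked depends only on
    which blocks are nonzero, so comparable vectors with equal block labels pick the same one. *)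
Definition sign x : bool :=
  if (sides_col true x == 0) && (sides_col false x == 0)
  then if [pick j | blk x j != sv0 (nb j)] is Some j then bsign x j else true
  else sides_col false x < sides_col true x.

Lemma on_sides_adj b x u v : on_sides b x u -> on_sides (~~ b) x v -> adj u v.
Proof.
move=> /forallP xu /forallP xv; apply/forallP => j.
exact: (on_side_adj (@sigma_inj j) (xu j) (xv j)).
Qed.

Lemma svle_on_sides b x y v : svle x y -> on_sides b x v -> on_sides b y v.
Proof.
move=> xy /forallP xv; apply/forallP => j.
exact: (svle_on_side (svle_blk xy) (xv j)).
Qed.

Lemma svle_sides_col b x y : svle x y -> sides_col b x <= sides_col b y.
Proof. by move=> xy; apply: maxcol_sub => v; apply: svle_on_sides. Qed.

Lemma sides_col_neq x : 0 < sides_col true x -> sides_col true x != sides_col false x.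
Proof. by apply: (maxcol_neq c_proper) => u v; apply: (@on_sides_adj true). Qed.

Lemma sides_col_opp b x : sides_col b (svopp x) = sides_col (~~ b) x.
Proof.
apply: eq_bigl => v; apply: eq_forallb => j.
by rewrite /on_side blk_opp side_opp.
Qed.

Lemma sides_col_gt0 b x : (0 < sides_col b x) = [forall j, 0 < scol j b x].
Proof.
apply/idP/forallP => [/maxcol_attained[v /forallP xv _] j|x_gt0].
  exact: leq_ltn_trans (leq0n _) (ltn_maxcol (@cH j) (xv j)).
have /fin_all_exists[e xe] : forall j, exists e, on_side (@sigma j) b (blk x j) e.
  by move=> j; have /maxcol_attained[e] := x_gt0 j; exists e.
pose v : G := [ffun j => e j].
apply: leq_ltn_trans (leq0n _) (@ltn_maxcol _ _ c _ v _).
by apply/forallP => j; rewrite ffunE.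
Qed.

Lemma t_le_N : t <= N.
Proof.
rewrite card_coord (bigD1 ord0) //=; apply: leq_trans (leq_addr _ _).
by rewrite nE; apply: leq_trans (t_k _) (leq_addl _ _).
Qed.

(** The bound [N - t] on a sum of block labels becomes a lower bound [t] on the total deficit. *)
Local Notation deficit x j := (nb j - blabel x j).

Lemma deficitE x : \sum_j blabel x j + \sum_j deficit x j = N.
Proof.
rewrite card_coord -big_split; apply: eq_bigr => j _ /=.
by rewrite subnKC // (block_label_le (@cH j) (nE j)).
Qed.

(* Two blocks with edges on a single, opposite, side contribute at least
   [2 * (t - 1)], which exceeds [t] because [t >= 3]. *)
Lemma deficit_ge x : sides_col true x = 0 -> sides_col false x = 0 ->
  t <= \sum_j deficit x j /\
  (\sum_j deficit x j = t -> exists j0,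
     [/\ scol j0 true x = 0, scol j0 false x = 0,
         t <= deficit x j0 & forall j, j != j0 -> deficit x j = 0]).
Proof.
move=> x1 x2.
have some_empty b : sides_col b x = 0 -> exists j, scol j b x = 0.
  move=> xb; have /forallPn[j] : ~~ [forall j, 0 < scol j b x].
    by rewrite -sides_col_gt0 xb.
  by rewrite lt0n negbK => /eqP; exists j.
(* An edge-free block has label at most [alt_sigma], so it alone lacks at least [k j], hence [t]; if
   the total is [t], the other blocks lack nothing. *)
have empty_block j : scol j true x = 0 -> scol j false x = 0 -> t <= \sum_j deficit x j /\
  (\sum_j deficit x j = t -> exists j0,
     [/\ scol j0 true x = 0, scol j0 false x = 0,
         t <= deficit x j0 & forall j, j != j0 -> deficit x j = 0]).
  move=> j1 j2; have t_d : t <= deficit x j.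
    have := alt_le_alt_sigma j1 j2; have := t_k j; have := nE j.
    by rewrite /block_label j1 j2 /=; lia.
  split=> [|d_t]; first exact: leq_trans t_d (@leq_sum1 _ (fun j => deficit x j) j).
  exists j; split=> // j' /(@leq_sum2 _ (fun j => deficit x j)).
  rewrite d_t => d_le; apply/eqP; rewrite -leqn0 -(leq_add2l t) addn0.
  by apply: leq_trans d_le; rewrite leq_add2r.
have [j1 j1E] := some_empty _ x1; have [j2 j2E] := some_empty _ x2.
have [/eqP j1f|j1f] := boolP (scol j1 false x == 0); first exact: (empty_block j1).
have [/eqP j2t|j2t] := boolP (scol j2 true x == 0); first exact: (empty_block j2).
have j12 : j2 != j1 by apply: contraNneq j2t => ->; rewrite j1E.
have d1 : k j1 <= (deficit x j1).+1.
  by have := nE j1; rewrite /block_label j1E (negbTE j1f) eqxx /=; lia.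
have d2 : k j2 <= (deficit x j2).+1.
  by have := nE j2; rewrite /block_label j2E (negbTE j2t) eqxx /=; lia.
have := leq_trans (t_k j1) d1; have := leq_trans (t_k j2) d2.
have := @leq_sum2 _ (fun j => deficit x j) _ _ j12 => /=; lia.
Qed.

Lemma label_le x : label x <= N.
Proof.
rewrite /label; case: ifP => _; first by have := deficitE x; lia.
have := maxcol_le c (on_sides true x); have := maxcol_le c (on_sides false x).
rewrite -!/(sides_col _ x); have := t_le_N; lia.
Qed.

Lemma svle_label x y : svle x y -> label x <= label y.
Proof.
move=> xy; have := svle_sides_col true xy; have := svle_sides_col false xy.
rewrite /label; case: ifP => [/andP[/eqP x1 /eqP x2]|x12];
  case: ifP => [y12|y12] *; try lia.
  by apply: leq_sum => j _; exact: (svle_block_label (@sigma j) (@cH j) (svle_blk xy)).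
(* Here [x] has a block sum, at most [N - t], and [y] a label shifted by [N - t]. *)
have := deficitE x; have [] := deficit_ge x1 x2; lia.
Qed.

(** Equal sums of monotone block labels agree block by block, so the same block decides with the
    same sign. Equal largest colors lie on the same side, since opposite sides have different
    ones. *)
Lemma svle_sign x y : svle x y -> x != sv0 N -> label x = label y -> sign x = sign y.
Proof.
move=> xy x0; have := svle_sides_col true xy; have := svle_sides_col false xy.
have := @sides_col_neq x; have := @sides_col_neq y.
rewrite /label /sign.
case: (boolP ((sides_col true x == 0) && (sides_col false x == 0))) => x12;
  case: (boolP ((sides_col true y == 0) && (sides_col false y == 0))) => y12.
- move=> _ _ _ _ /leq_sum_eq eq_xy.
  have {}eq_xy j : blabel x j = blabel y j.
    by apply: eq_xy => i; exact: (svle_block_label (@sigma i) (@cH i) (svle_blk xy)).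
  have eq0 j : (blk x j != sv0 (nb j)) = (blk y j != sv0 (nb j)).
    have gt0 (z : signvec N) : (blk z j != sv0 (nb j)) = (0 < blabel z j).
      apply/idP/idP; first exact: block_label_gt0.
      by apply: contraTneq => ->; rewrite block_label0.
    by rewrite !gt0 eq_xy.
  rewrite -(eq_pick eq0); case: pickP => // j xj.
  exact: (svle_block_sign (nE j) (@sigma_inj j) (@cH_proper j) (svle_blk xy) xj (eq_xy j)).
- move=> *; exfalso; case/andP: x12 => /eqP x1 /eqP x2.
  have := deficitE x; have [] := deficit_ge x1 x2; lia.
- move=> *; exfalso; lia.
- by move=> *; apply/idP/idP; lia.
Qed.

Lemma sign_opp x : x != sv0 N -> sign (svopp x) = ~~ sign x.
Proof.
move=> x0; rewrite /sign !sides_col_opp andbC.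
case: ifP => x12; last first.
  have := @sides_col_neq x; rewrite /= -leqNgt => col_neq.
  by rewrite /= in x12; apply/idP/idP; lia.
have eq0 j : (blk (svopp x) j != sv0 (nb j)) = (blk x j != sv0 (nb j)).
  by rewrite blk_opp svopp_eq0.
rewrite (eq_pick eq0); case: pickP => [j xj|no_j].
  by rewrite blk_opp block_sign_opp.
by have [j] := blk_neq0 x0; rewrite no_j.
Qed.

Lemma label_gt0 x : x != sv0 N -> 0 < label x.
Proof.
move=> x0; rewrite /label; case: ifP => x12; last by lia.
have [j xj] := blk_neq0 x0.
exact: leq_trans (block_label_gt0 (@sigma j) (@cH j) xj) (leq_sum1 _ j).
Qed.

(** * Labels along alternating flags *)

Lemma fvec0 (F : flag N) : fvec 0 F = sv0 N.
Proof. by apply/ffunP => i; rewrite !ffunE. Qed.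

Lemma label0 : label (sv0 N) = 0.
Proof.
have col0 b : sides_col b (sv0 N) = 0.
  apply/eqP; rewrite -leqn0 leqNgt sides_col_gt0; apply/forallPn; exists ord0.
  by rewrite blk0 side_col0.
rewrite /label !col0 /= big1 // => j _.
by rewrite blk0 block_label0.
Qed.

(** Equal consecutive labels would force equal signs, against alternation; so the labels increase
    strictly and [increasing_squeeze] applies. *)
Lemma flag_label a m e (F : flag N) : a + m = N -> word sign a m F = altw e m ->
    a < label (fvec a.+1 F) ->
  forall i, i < m -> label (fvec (a + i).+1 F) = (a + i).+1.
Proof.
move=> amN wF lab_gt; apply: (@increasing_squeeze (fun i => label (fvec (a + i).+1 F))).
- move=> i im; have xy : svle (fvec (a + i).+1 F) (fvec (a + i.+1).+1 F).
    by apply: svle_fvec; rewrite addnS.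
  rewrite ltn_neqAle svle_label // andbT; apply/eqP => /(svle_sign xy) E.
  have : sign (fvec (a + i).+1 F) = sign (fvec (a + i.+1).+1 F).
    by apply: E; apply: fvec_neq0; lia.
  have signE l : l < m -> sign (fvec (a + l).+1 F) = e (+) odd l.
    by move=> lm; rewrite -(@nth_word _ sign true a m l F lm) wF nth_altw.
  by rewrite !signE ?(ltnW im) //=; case: (e) (odd i) => [] [].
- by rewrite addn0.
- by move=> i; rewrite amN label_le.
Qed.

Lemma full_flag_label (F : flag N) r : word sign 0 N F = altw true N -> r <= N ->
  label (fvec r F) = r.
Proof.
move=> wF; case: r => [|r] kN; first by rewrite fvec0 label0.
rewrite -[r]add0n; apply: (flag_label _ wF _ kN) => //.
by apply/label_gt0/fvec_neq0; rewrite /= (leq_trans _ kN).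
Qed.

Lemma low_label x : label x <= N - t ->
  [/\ sides_col true x = 0, sides_col false x = 0 & label x = \sum_j blabel x j].
Proof.
rewrite /label; case: ifP => [/andP[/eqP -> /eqP ->]//|x12]; lia.
Qed.

Lemma high_label x i : label x = N - t + i.+1 ->
  maxn (sides_col true x) (sides_col false x) = i.+1.
Proof.
rewrite /label; case: ifP => [/andP[/eqP x1 /eqP x2]|_]; last by lia.
by have := deficitE x; have [] := deficit_ge x1 x2; lia.
Qed.

(** Up to [N - t] each step raises the sum of block labels by one and touches a single block, whose
    label and support both grow by one. A block of full label thus has no free coordinate. *)
Lemma block_label_le_supp (F : flag N) r j :
    word sign 0 N F = altw true N -> r <= N - t ->
  blabel (fvec r F) j <= supp_size (blk (fvec r F) j).
Proof.
move=> wF; elim: r j => [|r IH] j k_le.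
  by rewrite fvec0 blk0 block_label0.
have kN : r < N by lia.
pose p := Ordinal kN; rewrite (@fvecS _ r F p) //.
have [j0 [i ui]] := at_blockP (F.1^-1 p)%g.
have sumE l : l <= N - t -> \sum_j blabel (fvec l F) j = l.
  move=> l_le; have lN : l <= N by lia.
  have lE := full_flag_label wF lN.
  by have [|_ _ <-] := @low_label (fvec l F); rewrite lE.
have := sumE _ k_le; rewrite (@fvecS _ r F p) // ui.
have [->{j}|jj0] := eqVneq j j0; last by rewrite blk_set_neq // => _; apply: IH; lia.
set y := svset _ _ _ => y_sum.
have /(sum_change (f := fun j => blabel y j)) : forall j, j != j0 ->
    blabel y j = blabel (fvec r F) j by move=> j' jj0; rewrite blk_set_neq.
rewrite y_sum sumE ?(ltnW k_le) // addSn -addnS => /addnI <-.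
rewrite blk_set supp_size_set ?ltnS ?IH ?(ltnW k_le) //.
by rewrite ffunE -ui fvec_unset // permKV.
Qed.

(* By [deficit_ge], [z] leaves [t] coordinates free, all in a single block, and
   the niceness of that block provides the edges. *)
Lemma full_flag_extends (F : flag N) u b (z := fvec (N - t) F) :
    word sign 0 N F = altw true N -> z u = None ->
  0 < sides_col b (svset z u b).
Proof.
move=> wF zu.
have zE : label z = N - t by apply: full_flag_label => //; lia.
have [|z1 z2 z_sum] := @low_label z; first by rewrite zE.
have d_sum := deficitE z; rewrite -z_sum zE in d_sum.
have d_t : \sum_j deficit z j = t by have := t_le_N; lia.
have [_ /(_ d_t)[]] := deficit_ge z1 z2.
move=> j0 [j01 j02 d0 d_other].
have [j [i ui]] := at_blockP u.
have le_supp j' := block_label_le_supp j' wF (leqnn _).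
have zji : blk z j i = None by rewrite ffunE -ui.
(* A block without deficit has full label, hence full support, so the free coordinate [u] lies in
   [j0]. *)
have jj0 : j = j0.
  apply/eqP/negPn/negP => /d_other/eqP; rewrite subn_eq0 => n_le.
  suff /(supp_size_full i) : supp_size (blk z j) = nb j by rewrite zji.
  by apply/eqP; rewrite eqn_leq supp_size_le (leq_trans n_le (le_supp j)).
subst j0; rewrite sides_col_gt0; apply/forallP => j'; rewrite ui.
have [->{j'}|j'j] := eqVneq j' j.
  (* The deficit of this edge-free block is at most [t], so its alternation number reaches
     [alt_sigma]. *)
  rewrite blk_set; apply: (block_extends (@alt_sigma_edge j)) => //.
  have := @leq_sum1 _ (fun j => deficit z j) j; rewrite d_t.
  by move: d0 (nE j) (t_k j); rewrite /block_label j01 j02 /=; lia.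
(* A label [alt_sigma + k j'] with [k j' > 1] can only come from a block with edges on both
   sides. *)
rewrite blk_set_neq //; have := d_other _ j'j.
have := nE j'; have := t_k j'; rewrite /block_label.
have := @alt_le_alt_sigma _ (@sigma j') _ (@cH j') (blk z j').
by case: (b); do !case: ifP; lia.
Qed.

(** * Colors of the tuples on extensions of one vector *)

Lemma sides_col_set_neq b x u : x u = None ->
  sides_col (~~ b) (svset x u b) = sides_col (~~ b) x.
Proof.
have [j [i ->]] := at_blockP u => xi.
apply: eq_bigl => v; apply: eq_forallb => j'; rewrite /on_side.
have [->//|[i' [ii' ->]]] := blk_svset x i b j'.
by rewrite side_set_neq // ffunE -ii'.
Qed.

Lemma on_sides_set_adj b (z : signvec N) u u' v w : z u = None -> z u' = None -> u != u' ->
  on_sides b (svset z u b) v -> on_sides (~~ b) (svset z u' (~~ b)) w -> adj v w.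
Proof.
move=> zu zu' uu' zv zw.
have yE : svset (svset z u b) u' (~~ b) = svset (svset z u' (~~ b)) u b.
  apply/ffunP => i; rewrite !ffunE; have [->|//] := eqVneq i u'.
  by rewrite eq_sym (negbTE uu').
apply: (@on_sides_adj b (svset (svset z u b) u' (~~ b))).
  apply: svle_on_sides zv; apply: svle_set.
  by rewrite ffunE eq_sym (negbTE uu').
rewrite yE; apply: svle_on_sides zw; apply: svle_set.
by rewrite ffunE (negbTE uu').
Qed.

Lemma on_sides_set_neq (z : signvec N) u v w : z u = None ->
  on_sides true (svset z u true) v -> on_sides false (svset z u false) w -> v != w.
Proof.
have [j [i ->]] := at_blockP u => zi /forallP/(_ j) + /forallP/(_ j).
rewrite !blk_set => vj wj; have zji : blk z j i = None by rewrite ffunE.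
have := on_side_set_neq (@sigma_inj j) (@no_singleton j) zji vj wj.
by apply: contraNneq => ->.
Qed.

(* In a flag with alternating signs after [z], the [i]-th step adds a coordinate
   to the side on which color [i] then appears as the largest color. *)
Lemma flag_step_color (F : flag N) e i (p : 'I_N) (z := fvec (N - t) F)
    (u := (F.1^-1 p)%g) (b := e (+) odd i) v :
    (forall u b, z u = None -> 0 < sides_col b (svset z u b)) ->
    label z = N - t -> word sign (N - t) t F = altw e t ->
    i < t -> p = N - t + i :> nat ->
  on_sides b (svset z u b) v -> c v <= i.
Proof.
move=> z_ext zE wF it pE zv.
have aN : N - t + t = N by rewrite subnK // t_le_N.
(* By [z_ext] the first step after [z] already creates a tuple, which starts the labels above
   [N - t]. *)
have z_lt : N - t < label (fvec (N - t).+1 F).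
  have lt_N : N - t < N by lia.
  pose p0 := Ordinal lt_N; rewrite (@fvecS _ _ F p0) //.
  set u0 := (_ p0); set b0 := F.2 _; rewrite ltnNge; apply/negP => /low_label[y1 y2 _].
  have := z_ext u0 b0; rewrite fvec_unset ?permKV // => /(_ erefl).
  by case: (b0) y1 y2 => y1 y2; rewrite ?y1 ?y2.
have lab i' : i' < t -> label (fvec (N - t + i').+1 F) = (N - t + i').+1.
  exact: (flag_label aN wF z_lt).
set x := fvec p F; set y := fvec p.+1 F.
have zx : svle z x by apply: svle_fvec; rewrite pE leq_addr.
have xu : x u = None by rewrite fvec_unset // permKV.
have yE : y = svset x u (F.2 u) by rewrite /y (@fvecS _ p F p).
have y_max : maxn (sides_col true y) (sides_col false y) = i.+1.
  by apply: high_label; rewrite /y pE lab // addnS.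
have y_sign : sign y = b.
  by rewrite /y pE -(@nth_word _ sign true (N - t) t i F it) wF nth_altw.
have x_le : label x <= N - t + i.
  rewrite /x pE; case: (i) it => [|i'] it; first by rewrite addn0 -/z zE.
  by rewrite addnS lab // ltnW.
have x_max : maxn (sides_col true x) (sides_col false x) <= i.
  move: x_le; rewrite /label; case: ifP => [/andP[/eqP -> /eqP ->]|_].
    by rewrite maxnn.
  by rewrite leq_add2l.
have y_b : sides_col b y = i.+1.
  move: y_sign; rewrite /sign; case: ifP => [/andP[/eqP y1 /eqP y2]|_].
    by rewrite y1 y2 in y_max.
  by case: (b); lia.
(* Had the step used the other sign, side [b] would be the same in [x] and [y], but its largest
   color rises to [i + 1]. *)
have ub : F.2 u = b.
  apply/eqP/negPn/negP => ub; have ub' : F.2 u = ~~ b by case: (F.2 u) (b) ub => [] [].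
  move: y_b; rewrite yE ub' -{1}[b]negbK sides_col_set_neq // negbK.
  move: x_max; rewrite geq_max => /andP[x1 x2].
  by case: (b) => xb; [move: x1 | move: x2]; rewrite xb ltnn.
have : c v < sides_col b y.
  apply: leq_trans (ltn_maxcol c zv) _; apply: svle_sides_col.
  by rewrite yE ub; apply: svle_svset.
by rewrite y_b ltnS.
Qed.

Lemma colorful_sides : exists A B : 'I_t -> G,
  [/\ forall i, c (A i) = i, forall i, c (B i) = i,
      forall i, A i != B i & forall i j, i != j -> adj (A i) (B j)].
Proof.
have aN : N - t + t.-1.+1 = N by have := t_le_N; lia.
have tE : t.-1.+1 = t by lia.
have [F [F' [zz' wF wF']]] := @fan_pair N sign sign_opp _ _ aN.
set z := fvec (N - t) F in zz'.
have zE : label z = N - t by apply: full_flag_label => //; lia.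
(* Obtained from [F], which alternates throughout, and used for [F'] as well, since both pass
   through [z]. *)
have z_ext u b : z u = None -> 0 < sides_col b (svset z u b).
  exact: full_flag_extends.
have wFt : word sign (N - t) t F = altw (~~ odd (N - t)) t.
  have NE : N = N - t + t by rewrite subnK // t_le_N.
  have : word sign 0 (N - t + t) F = altw true (N - t + t) by rewrite -NE.
  by rewrite word_cat altwD => /eqP; rewrite eqseq_cat ?size_word ?size_altw // => /andP[_ /eqP].
rewrite tE in wF'.
(* After [z], the signs of [F] start with [e] and those of [F'] with its negation. *)
set e := ~~ odd (N - t) in wFt.
have {}wF' : word sign (N - t) t F' = altw (~~ e) t by rewrite negbK.
have lt_pos (i : 'I_t) : N - t + i < N by have := ltn_ord i; have := t_le_N; lia.
pose pos i := Ordinal (lt_pos i).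
pose u i := (F.1^-1 (pos i))%g; pose u' i := (F'.1^-1 (pos i))%g.
have zu i : z (u i) = None by rewrite fvec_unset // permKV leq_addr.
have zu' i : z (u' i) = None by rewrite zz' fvec_unset // permKV leq_addr.
have pos_inj : injective pos by move=> i j /(congr1 val) /= /addnI /ord_inj.
have u_inj : injective u by move=> i j /perm_inj /pos_inj.
have u'_inj : injective u' by move=> i j /perm_inj /pos_inj.
have le_c (i : 'I_t) v (b := e (+) odd i) : on_sides b (svset z (u i) b) v -> c v <= i.
  exact: (flag_step_color z_ext zE wFt).
have le_c' (i : 'I_t) v (b := ~~ (e (+) odd i)) : on_sides b (svset z (u' i) b) v -> c v <= i.
  rewrite /b -addNb /u' zz'; apply: flag_step_color; rewrite -?zz' //.
have pick_v p b : z p = None -> exists v, on_sides b (svset z p b) v.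
  by move=> zp; have /maxcol_attained[v] := z_ext p b zp; exists v.
have c_neq b p p' v w : z p = None -> z p' = None -> p != p' ->
    on_sides b (svset z p b) v -> on_sides (~~ b) (svset z p' (~~ b)) w -> c v != c w.
  move=> zp zp' pp' pv pw; have /forallP/(_ v)/forallP/(_ w)/implyP := c_proper; apply.
  exact: on_sides_set_adj pv pw.
have main m (i : 'I_t) : i = m :> nat ->
    u i = u' i /\ forall b v, on_sides b (svset z (u i) b) v -> c v = i.
  elim/ltn_ind: m i => m IH i im; set b := e (+) odd i.
  (* A smaller color is excluded: by induction some tuple on the opposite side, at the coordinate
     [u (c v)], has that color, and it is adjacent to [v]. *)
  have c_i v : on_sides b (svset z (u i) b) v -> c v = i.
    move=> iv; have := le_c _ _ iv; rewrite leq_eqVlt => /orP[/eqP/ord_inj//|].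
    rewrite im => lt_m; have [_ cj] := IH _ lt_m (c v) erefl.
    have [w jw] := pick_v (u (c v)) (~~ b) (zu _).
    suff : c v != c w by rewrite (cj _ _ jw) eqxx.
    apply: c_neq iv jw => //; apply: contraTneq lt_m => /u_inj <-.
    by rewrite im ltnn.
  have c_i' v : on_sides (~~ b) (svset z (u' i) (~~ b)) v -> c v = i.
    move=> iv; have := le_c' _ _ iv; rewrite leq_eqVlt => /orP[/eqP/ord_inj//|].
    rewrite im => lt_m; have [uu' cj] := IH _ lt_m (c v) erefl.
    have [w jw] := pick_v (u (c v)) b (zu _).
    suff : c w != c v by rewrite (cj _ _ jw) eqxx.
    apply: c_neq jw iv => //; rewrite uu'; apply: contraTneq lt_m => /u'_inj ->.
    by rewrite im ltnn.
  (* Otherwise tuples on opposite sides at these two coordinates would be adjacent, both of color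
     [i]. *)
  have uu' : u i = u' i.
    apply/eqP/negPn/negP => uu'; have [v iv] := pick_v (u i) b (zu _).
    have [w iw] := pick_v (u' i) (~~ b) (zu' _).
    by have := c_neq _ _ _ _ _ (zu i) (zu' i) uu' iv iw; rewrite c_i // c_i' // eqxx.
  split=> // b' v; have [->|b'b] := eqVneq b' b; first exact: c_i.
  have -> : b' = ~~ b by case: b' (b) b'b => [] [].
  by rewrite uu'; apply: c_i'.
have {}main i b v : on_sides b (svset z (u i) b) v -> c v = i.
  by have [_ ] := main i i erefl; apply.
have /fin_all_exists[A zA] : forall i, exists v, on_sides true (svset z (u i) true) v.
  by move=> i; apply: pick_v.
have /fin_all_exists[B zB] : forall i, exists v, on_sides false (svset z (u i) false) v.
  by move=> i; apply: pick_v.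
exists A, B; split=> [i|i|i|i j ij]; try exact: main.
- exact: on_sides_set_neq (zA i) (zB i).
- by apply: on_sides_set_adj (zA i) (zB j); rewrite ?(inj_eq u_inj).
Qed.

End Product.

(** * Small chromatic numbers and conclusion *)

Lemma bigmin_le (x : nat) n (F : 'I_n -> nat) (j : 'I_n) :
  \big[minn/x]_(i < n) F i <= F j.
Proof.
have : j \in index_enum 'I_n by exact: mem_index_enum.
elim: (index_enum _) => // i r IH; rewrite big_cons inE => /predU1P[->|/IH].
  exact: geq_minl.
by apply: leq_trans; apply: geq_minr.
Qed.

Lemma colorable_chi (G : graph) : colorable G (chi G).
Proof. by rewrite /chi; case: ex_minnP. Qed.

Definition colorful_Kstar (G : graph) (t : nat) (c : G -> 'I_t) : Prop :=
  exists f : Kstar t -> G,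
    [/\ is_copy f,
        all_colors_appear (fun u : Kstar t => c (f u)),
        all_colors_appear (fun i : 'I_t => c (f (inl i)))
      & all_colors_appear (fun i : 'I_t => c (f (inr i)))].

Lemma colorful_KstarI (G : graph) (t : nat) (c : G -> 'I_t) (A B : 'I_t -> G) :
    (forall i, c (A i) = i) -> (forall i, c (B i) = i) ->
    (forall i, A i != B i) -> (forall i j, i != j -> adj (A i) (B j)) ->
  colorful_Kstar c.
Proof.
move=> cA cB A_B AB.
exists (fun u : 'I_t + 'I_t => match u with inl i => A i | inr i => B i end).
split=> [|i|i|i]; [|by exists (inl i)|by exists i|by exists i].
have A_neq i j : A i <> B j.
  move=> ABij; have ij : i = j by rewrite -(cA i) ABij cB.
  by move/eqP: (A_B i); rewrite ABij ij.
split=> [[i|i] [j|j] E|[i|i] [j|j] //= ij].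
- by congr inl; rewrite -(cA i) E cA.
- by case: (A_neq _ _ E).
- by case: (A_neq _ _ (esym E)).
- by congr inr; rewrite -(cB i) E cB.
- exact: AB.
- by rewrite adj_sym AB // eq_sym.
Qed.

(** With two colors, each edge determines the color of its second end: [v2] gets that of [u2], and
    [v1] that of [u1]. *)
Lemma colorful_K22 (G : graph) (c : G -> 'I_2) (u1 u2 v1 v2 : G) :
    proper_coloring c -> c u1 != c u2 -> adj u1 v2 -> adj u2 v1 ->
    u1 != v1 -> u2 != v2 ->
  colorful_Kstar c.
Proof.
move=> c_proper cu uv1 uv2 uv1' uv2'.
have c_neq u v : adj u v -> c u != c v.
  by move=> uv; have /forallP/(_ u)/forallP/(_ v)/implyP := c_proper; apply.
have ord2 (p q r : 'I_2) : p != q -> p != r -> q = r.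
  by case: p q r => [[|[|//]] ?] [[|[|//]] ?] [[|[|//]] ?] // *; apply: val_inj.
have cv2 : c v2 = c u2 by exact: ord2 (c_neq _ _ uv1) cu.
have cu' : c u2 != c u1 by rewrite eq_sym.
have cv1 : c v1 = c u1 by exact: ord2 (c_neq _ _ uv2) cu'.
pose A i := if i == c u1 then u1 else u2; pose B i := if i == c u1 then v1 else v2.
apply: (@colorful_KstarI _ _ _ A B) => [i|i|i|i j ij]; rewrite /A /B.
- by case: (eqVneq i (c u1)) => // i1; apply: (ord2 (c u1)); rewrite // eq_sym.
- case: (eqVneq i (c u1)) => [-> //|i1]; rewrite cv2.
  by apply: (ord2 (c u1)); rewrite // eq_sym.
- by case: (eqVneq i (c u1)).
- case: (eqVneq i (c u1)) ij => [->|i1] ij; case: (eqVneq j (c u1)) => [jE|j1] //.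
    by rewrite jE eqxx in ij.
  by move/eqP: ij => []; apply: (ord2 (c u1)); rewrite eq_sym.
Qed.

Theorem theorem5 (s : nat) (H : 'I_s.+1 -> hypergraph)
    (H_nice : forall j : 'I_s.+1, nice (H j))
    (t : nat)
    (t_min : t = \big[minn/chi (KG (H ord0))]_(j < s.+1) chi (KG (H j)))
    (c : cat_prod (fun j : 'I_s.+1 => KG (H j)) -> 'I_t)
    (c_proper : proper_coloring c) :
  exists f : Kstar t -> cat_prod (fun j : 'I_s.+1 => KG (H j)),
    [/\ is_copy f,
        all_colors_appear (fun u : Kstar t => c (f u)),
        all_colors_appear (fun i : 'I_t => c (f (inl i)))
      & all_colors_appear (fun i : 'I_t => c (f (inr i)))].
Proof.
have t_chi j : t <= chi (KG (H j)) by rewrite t_min bigmin_le.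
have no_singleton j : forall v : hvertex (H j), [set v] \notin hedges (H j).
  by case: (H_nice j).
have /fin_all_exists[sigma sigmaP] : forall j,
    exists sigma : 'I_#|hvertex (H j)| -> hvertex (H j),
    [/\ injective sigma, #|hvertex (H j)| = alt_sigma sigma + chi (KG (H j))
      & forall x : signvec #|hvertex (H j)|,
          alt_sigma sigma <= alt x -> alt_sigma sigma < supp_size x ->
          contains_edge (sigma @: pos_part x)
          || contains_edge (sigma @: neg_part x)].
  move=> j; have [_ _ [sigma [/bij_inj sigma_inj chiE edgeP]]] := H_nice j.
  exists sigma; split=> //; rewrite chiE subnKC //.
  by apply/bigmax_leqP => x _; apply: leq_trans (alt_le_supp x) (supp_size_le x).
have /fin_all_exists[cH cH_proper] : forall j, exists cj : {ffun KG (H j) -> 'I_(chi (KG (H j)))},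
    proper_coloring cj by move=> j; apply/existsP/colorable_chi.
have sigma_inj j : injective (@sigma j) by case: (sigmaP j).
have nE j : #|hvertex (H j)| = alt_sigma (@sigma j) + chi (KG (H j)) by case: (sigmaP j).
have edgeP j := let: And3 _ _ P := sigmaP j in P.
clear t_min; rewrite -/(colorful_Kstar c).
case: (ltnP 2 t) => [t_ge3|].
  have [A [B [cA cB AB adjAB]]] := @colorful_sides s H sigma sigma_inj _ cH
    cH_proper nE no_singleton edgeP t c c_proper t_chi t_ge3.
  exact: colorful_KstarI cA cB AB adjAB.
case: t c c_proper t_chi => [|[|[|//]]] c c_proper t_chi _.
- have A : 'I_0 -> cat_prod (fun j => KG (H j)) by case.
  by apply: (@colorful_KstarI _ 0 c A A) => -[].
(* [Kstar 1] has no edges, so two distinct tuples suffice. *)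
- have /fin_all_exists[e /fin_all_exists[f ef]] : forall j, exists e f : KG (H j), e != f.
    move=> j; exact: (block_edge_pair (cH j) (nE j) (@sigma_inj j) (@no_singleton j) (edgeP j)).
  pose u : cat_prod (fun j => KG (H j)) := [ffun j => e j].
  pose v : cat_prod (fun j => KG (H j)) := [ffun j => f j].
  apply: (@colorful_KstarI _ 1 c (fun=> u) (fun=> v)) => [i|i|_|i j].
  + by rewrite !ord1.
  + by rewrite !ord1.
  + by apply: contra (ef ord0) => /eqP/ffunP/(_ ord0); rewrite !ffunE => ->.
  + by rewrite !ord1.
have /fin_all_exists[e1 /fin_all_exists[e2 /fin_all_exists[f1 /fin_all_exists[f2 quad]]]] :
    forall j, exists e1 e2 f1 f2 : KG (H j),
    [/\ adj e1 f2, adj e2 f1, e1 != f1 & e2 != f2] /\ e1 != e2 /\ f1 != f2.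
  move=> j; exact: (block_edge_quad (cH j) (nE j) (@sigma_inj j) (@no_singleton j) (edgeP j)).
pose tuple (e : forall j, KG (H j)) : cat_prod (fun j => KG (H j)) := [ffun j => e j].
have tuple_neq (e f : forall j, KG (H j)) : e ord0 != f ord0 -> tuple e != tuple f.
  by apply: contra => /eqP/ffunP/(_ ord0); rewrite !ffunE => ->.
have tuple_adj (e f : forall j, KG (H j)) : (forall j, adj (e j) (f j)) -> adj (tuple e) (tuple f).
  by move=> ef; apply/forallP => j; rewrite !ffunE.
have [[_ _ e1f1 e2f2] [e12 f12]] := quad ord0.
have adj12 : adj (tuple e1) (tuple f2) by apply: tuple_adj => j; have [[]] := quad j.
have adj21 : adj (tuple e2) (tuple f1) by apply: tuple_adj => j; have [[]] := quad j.
have [ce|ce] := eqVneq (c (tuple e1)) (c (tuple e2)); last first.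
  by apply: colorful_K22 c_proper ce adj12 adj21 _ _; apply: tuple_neq.
(* Now [tuple f1], adjacent to [tuple e2], differs in color from [tuple e1]; the same two edges are
   read with sides [e1], [f1] and [e2], [f2]. *)
apply: (@colorful_K22 _ _ (tuple e1) (tuple f1) (tuple e2) (tuple f2)) => //;
  try exact: tuple_neq.
  by rewrite ce; have /forallP/(_ (tuple e2))/forallP/(_ (tuple f1))/implyP := c_proper; apply.
by rewrite adj_sym.
Qed.
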